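(* Let $(A,\Delta)$ be a left multiplier Hopf algebra. Then $(A,\Delta)$ is a regular multiplier Hopf algebra.
   Context: Algebras are associative algebras over $\mathbb C$, not necessarily unital, and $A$ is non-degenerate: if $ab=0$ for all $b\in A$ then $a=0$, and if $ab=0$ for all $a\in A$ then $b=0$. $M(A)$ denotes the multiplier algebra of $A$ (the largest unital algebra containing $A$ as an essential ideal), and $A\otimes A\subseteq M(A)\otimes M(A)\subseteq M(A\otimes A)$. $\iota$ is the identity map. Let $\Delta:A\to M(A\otimes A)$ be a homomorphism. The canonical maps $T_1,T_2,T_3,T_4: A\otimes A\to M(A\otimes A)$ are the linear maps given by $$T_1(a\otimes b)=\Delta(a)(1\otimes b),\quad T_2(c\otimes a)=(c\otimes 1)\Delta(a),\quad T_3(a\otimes b)=(1\otimes b)\Delta(a),\quad T_4(c\otimes a)=\Delta(a)(c\otimes 1).$$ A canonical map is called regular if its range is contained in $A\otimes A$. $(A,\Delta)$ is a left multiplier Hopf algebra if $T_1$ and $T_4$ are regular, $\Delta$ is coassociative in the sense that $$((\Delta\otimes\iota)(\Delta(a)(1\otimes b)))(c\otimes 1\otimes 1)=((\iota\otimes\Delta)(\Delta(a)(c\otimes 1)))(1\otimes 1\otimes b)$$ in $M(A\otimes A\otimes A)$ for all $a,b,c\in A$, and $T_1$ and $T_4$ are bijective maps from $A\otimes A$ to itself. $(A,\Delta)$ is a multiplier Hopf algebra if $T_1$ and $T_2$ are regular, $\Delta$ is coassociative in the sense that $$(c\otimes 1\otimes 1)((\Delta\otimes\iota)(\Delta(a)(1\otimes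 b)))=((\iota\otimes\Delta)((c\otimes 1)\Delta(a)))(1\otimes 1\otimes b)$$ for all $a,b,c\in A$, and $T_1,T_2$ are bijections from $A\otimes A$ to itself. It is called regular if moreover all four canonical maps $T_1,T_2,T_3,T_4$ are regular and are bijections from $A\otimes A$ to itself. *)

(* Defs.v *)
From HB Require Import structures.
From mathcomp Require Import all_boot all_algebra.
From mathcomp Require Import finmap generic_quotient ring_quotient monalg.
From mathcomp Require Import boolp reals complex.

Set Implicit Arguments.
Unset Strict Implicit.
Unset Printing Implicit Defensive.

Import GRing.Theory.
Local Open Scope ring_scope.
Local Open Scope quotient_scope.

Reserved Notation "u \ox v" (at level 40, left associativity).
Reserved Notation "a ** b" (at level 40, left associativity).

Section Tensor.
Variables (K : fieldType) (U V : lmodType K).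

Local Notation free := {malg K[(U * V)%type]}.

(* The subspace by which the free vector space on [U * V] is divided. *)
Inductive tensor_rel : free -> Prop :=
| tensor_rel0 : tensor_rel 0
| tensor_relP c x y : tensor_rel x -> tensor_rel y -> tensor_rel (c *: x + y)
| tensor_rel_l c u u' v :
    tensor_rel (<< (c *: u + u', v) >> - (c *: << (u, v) >> + << (u', v) >>))
| tensor_rel_r c u v v' :
    tensor_rel (<< (u, c *: v + v') >> - (c *: << (u, v) >> + << (u, v') >>)).

Definition tensor_relb (x : free) : bool := `[< tensor_rel x >].

Lemma tensor_relbE x : (x \in tensor_relb) = `[< tensor_rel x >].
Proof. by []. Qed.

Lemma tensor_relbP x : reflect (tensor_rel x) (x \in tensor_relb).
Proof. by rewrite tensor_relbE; apply: asboolP. Qed.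

Lemma tensor_relb_zmod_closed : zmod_closed tensor_relb.
Proof.
split=> [|x y /tensor_relbP xI /tensor_relbP yI].
  by apply/tensor_relbP; exact: tensor_rel0.
by apply/tensor_relbP; rewrite addrC -scaleN1r; exact: tensor_relP.
Qed.

HB.instance Definition _ :=
  GRing.isZmodClosed.Build free tensor_relb tensor_relb_zmod_closed.

Definition tensor_sub : zmodClosed free :=
  GRing.ZmodClosed.clone free tensor_relb _.

(* The record and the locks below keep unification from unfolding the
   quotient; [tensE], [tlift_tens] and [tensor_ind] characterize the type. *)
Record tensor : Type := Tensor { tensor_class : {ideal_quot tensor_sub} }.

HB.instance Definition _ := [isNew for tensor_class].
HB.instance Definition _ := [Choice of tensor by <:].

Fact tpi_key : unit. Proof. by []. Qed.
Fact trepr_key : unit. Proof. by []. Qed.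
Definition tpi : free -> tensor :=
  locked_with tpi_key (fun x => Tensor (\pi x)).
Definition trepr : tensor -> free :=
  locked_with trepr_key (fun t => repr (tensor_class t)).

Lemma treprK t : tpi (trepr t) = t.
Proof. by case: t => t; rewrite /tpi /trepr !locked_withE /= reprK. Qed.

Lemma tpi_eq x y : tensor_rel (x - y) <-> tpi x = tpi y.
Proof.
have h : (x - y \in tensor_relb) = (x == y %[mod {ideal_quot tensor_sub}]).
  exact: Quotient.idealrBE.
rewrite /tpi locked_withE.
split=> [xy|[/eqP xy]]; last by apply/tensor_relbP; rewrite h.
by congr Tensor; apply/eqP; rewrite -h; apply/tensor_relbP.
Qed.

Fact tzero_key : unit. Proof. by []. Qed.
Fact topp_key : unit. Proof. by []. Qed.
Fact tadd_key : unit. Proof. by []. Qed.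
Fact tscale_key : unit. Proof. by []. Qed.

Definition tzero : tensor := locked_with tzero_key (tpi 0).
Definition topp : tensor -> tensor :=
  locked_with topp_key (fun t => tpi (- trepr t)).
Definition tadd : tensor -> tensor -> tensor :=
  locked_with tadd_key (fun s t => tpi (trepr s + trepr t)).
Definition tscale : K -> tensor -> tensor :=
  locked_with tscale_key (fun c t => tpi (c *: trepr t)).

Lemma tzeroE : tzero = tpi 0.
Proof. exact: locked_withE. Qed.
Lemma toppE t : topp t = tpi (- trepr t).
Proof. by rewrite /topp locked_withE. Qed.
Lemma taddE s t : tadd s t = tpi (trepr s + trepr t).
Proof. by rewrite /tadd locked_withE. Qed.
Lemma tscaleE c t : tscale c t = tpi (c *: trepr t).
Proof. by rewrite /tscale locked_withE. Qed.

Lemma tensor_relZ c x : tensor_rel x -> tensor_rel (c *: x).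
Proof.
by move=> xI; rewrite -[_ *: _]addr0; apply: tensor_relP => //; exact: tensor_rel0.
Qed.

Lemma tpi_scale c x : tpi (c *: x) = tscale c (tpi x).
Proof. by rewrite tscaleE; apply/tpi_eq; rewrite -scalerBr; apply/tensor_relZ/tpi_eq; rewrite treprK. Qed.

Lemma tpi_opp x : tpi (- x) = topp (tpi x).
Proof. by rewrite -scaleN1r tpi_scale toppE tscaleE -scaleN1r. Qed.

Lemma tpi_add x y : tpi (x + y) = tadd (tpi x) (tpi y).
Proof.
rewrite taddE; apply/tpi_eq; rewrite opprD addrACA -[x + _]scale1r.
by apply: tensor_relP; apply/tpi_eq; rewrite treprK.
Qed.

Lemma taddA : associative tadd.
Proof.
by move=> r s t; rewrite -[r]treprK -[s]treprK -[t]treprK -!tpi_add addrA.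
Qed.

Lemma taddC : commutative tadd.
Proof. by move=> s t; rewrite -[s]treprK -[t]treprK -!tpi_add addrC. Qed.

Lemma tadd0 : left_id tzero tadd.
Proof. by move=> t; rewrite -[t]treprK tzeroE -tpi_add add0r. Qed.

Lemma taddN : left_inverse tzero topp tadd.
Proof. by move=> t; rewrite -[t]treprK -tpi_opp -tpi_add addNr tzeroE. Qed.

HB.instance Definition _ := GRing.isZmodule.Build tensor taddA taddC tadd0 taddN.

Lemma tscaleA a b t : tscale a (tscale b t) = tscale (a * b) t.
Proof. by rewrite -[t]treprK -!tpi_scale scalerA. Qed.

Lemma tscale1 : left_id 1 tscale.
Proof. by move=> t; rewrite -[t]treprK -tpi_scale scale1r. Qed.

Lemma tpiD x y : tpi (x + y) = tpi x + tpi y.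
Proof. exact: tpi_add. Qed.

Lemma tscaleDr : right_distributive tscale +%R.
Proof.
by move=> a s t; rewrite -[s]treprK -[t]treprK -tpiD -!tpi_scale scalerDr tpiD.
Qed.

Lemma tscaleDl t : {morph tscale^~ t : a b / a + b}.
Proof. by move=> a b; rewrite -[t]treprK -!tpi_scale scalerDl tpiD. Qed.

HB.instance Definition _ := GRing.Zmodule_isLmodule.Build K tensor
  tscaleA tscale1 tscaleDr tscaleDl.

Lemma tpiZ c x : tpi (c *: x) = c *: tpi x.
Proof. exact: tpi_scale. Qed.

Fact tens_key : unit. Proof. by []. Qed.

Definition tens : U -> V -> tensor :=
  locked_with tens_key (fun u v => tpi << (u, v) >>).

Lemma tensE u v : tens u v = tpi << (u, v) >>.
Proof. by rewrite /tens locked_withE. Qed.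

Lemma tens_bilinear : bilinear_for *:%R *:%R tens.
Proof.
split=> [v c u u'|u c v v']; rewrite /= !tensE -tpiZ -tpiD.
  by apply/tpi_eq; exact: tensor_rel_l.
by apply/tpi_eq; exact: tensor_rel_r.
Qed.

HB.instance Definition _ :=
  bilinear_isBilinear.Build K U V tensor *:%R *:%R tens tens_bilinear.

Lemma tensDZl c u u' v : tens (c *: u + u') v = c *: tens u v + tens u' v.
Proof. exact: (tens_bilinear.1 v c u u'). Qed.

Lemma tensDZr c u v v' : tens u (c *: v + v') = c *: tens u v + tens u v'.
Proof. exact: (tens_bilinear.2 u c v v'). Qed.

Lemma tensor_ind (P : tensor -> Prop) :
  P 0 -> (forall c u v t, P t -> P (c *: tens u v + t)) -> forall t, P t.
Proof.
move=> P0 PD t; rewrite -[t]treprK [trepr t]monalgE.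
elim: (msupp (trepr t) : seq _) => [|[u v] r IH].
  by rewrite big_nil -tzeroE.
rewrite big_cons tpiD.
have -> : << (trepr t)@_(u, v) *g (u, v) >> =
          (trepr t)@_(u, v) *: << (u, v) >> :> free.
  by apply/malgP => k; rewrite mcoeffZ !mcoeffU mulr_natr.
by rewrite tpiZ -tensE; exact: PD.
Qed.

End Tensor.

Notation "u \ox v" := (tens u v) : ring_scope.

Section Lift.
Variables (K : fieldType) (U V W : lmodType K) (f : U -> V -> W).
Variable fB : bilinear_for *:%R *:%R f.

Local Notation free := {malg K[(U * V)%type]}.

Definition free_eval (x : free) : W :=
  \sum_(k <- msupp x) x@_k *: f k.1 k.2.

Lemma free_evalEw (x : free) (D : {fset (U * V)%type}) :
  (msupp x `<=` D)%fset -> free_eval x = \sum_(k <- D) x@_k *: f k.1 k.2.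
Proof.
move=> xD; apply: big_fset_incl => // k _ /mcoeff_outdom ->.
by rewrite scale0r.
Qed.

Lemma free_eval_linear : linear free_eval.
Proof.
move=> c x y; pose D := (msupp x `|` msupp y `|` msupp (c *: x + y))%fset.
have xD : (msupp x `<=` D)%fset by rewrite /D -fsetUA fsubsetUl.
have yD : (msupp y `<=` D)%fset by rewrite /D fsetUAC fsubsetUr.
rewrite (free_evalEw xD) (free_evalEw yD) (@free_evalEw _ D) ?fsubsetUr //.
rewrite scaler_sumr -big_split /=; apply: eq_bigr => k _.
by rewrite mcoeffD mcoeffZ scalerDl scalerA.
Qed.

HB.instance Definition _ :=
  GRing.isLinear.Build K free W *:%R free_eval free_eval_linear.

Lemma free_evalU u v : free_eval << (u, v) >> = f u v.
Proof. by rewrite (free_evalEw msuppU_le) big_seq_fset1 mcoeffUU scale1r. Qed.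

Lemma free_eval_rel x : tensor_rel x -> free_eval x = 0.
Proof.
elim=> {x} [|c x y _ xI _ yI|c u u' v|c u v v'].
- by rewrite linear0.
- by rewrite linearP /= xI yI scaler0 addr0.
- by rewrite linearB linearP /= !free_evalU (fB.1 v c u u') subrr.
- by rewrite linearB linearP /= !free_evalU (fB.2 u c v v') subrr.
Qed.

Fact tlift_key : unit. Proof. by []. Qed.

Definition tlift of bilinear_for *:%R *:%R f : tensor U V -> W :=
  locked_with tlift_key (fun t => free_eval (trepr t)).

Lemma tlift_pi x : tlift fB (tpi x) = free_eval x.
Proof.
rewrite /tlift locked_withE.
apply/eqP; rewrite -subr_eq0 -linearB; apply/eqP/free_eval_rel/tpi_eq.
by rewrite treprK.
Qed.

Lemma tlift_linear : linear (tlift fB).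
Proof.
move=> c s t; rewrite -[s]treprK -[t]treprK -tpiZ -tpiD !tlift_pi.
exact: linearP.
Qed.

HB.instance Definition _ :=
  GRing.isLinear.Build K (tensor U V) W *:%R (tlift fB) tlift_linear.

Lemma tlift_tens u v : tlift fB (u \ox v) = f u v.
Proof. by rewrite tensE tlift_pi free_evalU. Qed.

End Lift.

Section TensorMaps.
Variable K : fieldType.

Lemma tensor_ext (U V W : lmodType K) (g h : {linear tensor U V -> W}) :
  (forall u v, g (u \ox v) = h (u \ox v)) -> g =1 h.
Proof.
move=> gh; elim/tensor_ind=> [|c u v t IH]; first by rewrite !linear0.
by rewrite !linearP gh IH.
Qed.

Lemma linear_exchange (W : lmodType K) a c (x y p q : W) :
  a *: (c *: x + y) + (c *: p + q) = c *: (a *: x + p) + (a *: y + q).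
Proof. by rewrite !scalerDr !scalerA [a * c]mulrC addrACA. Qed.

Section Map.
Variables (U V U' V' : lmodType K).
Variables (f : {linear U -> U'}) (g : {linear V -> V'}).

Definition tens_map (u : U) (v : V) : tensor U' V' := f u \ox g v.

Lemma tens_map_bilinear : bilinear_for *:%R *:%R tens_map.
Proof.
by split=> [v c u u'|u c v v']; rewrite /tens_map linearP ?linearPl ?linearPr.
Qed.

Definition tmap : tensor U V -> tensor U' V' := tlift tens_map_bilinear.

Lemma tmap_linear : linear tmap.
Proof. exact: tlift_linear. Qed.

HB.instance Definition _ :=
  GRing.isLinear.Build K (tensor U V) (tensor U' V') *:%R tmap tmap_linear.

Lemma tmapE u v : tmap (u \ox v) = f u \ox g v.
Proof. exact: tlift_tens. Qed.

End Map.

Section Assoc.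
Variables U V W : lmodType K.

Definition tens_assoc_at (w : W) (u : U) (v : V) : tensor U (tensor V W) :=
  u \ox (v \ox w).

Lemma tens_assoc_at_bilinear w : bilinear_for *:%R *:%R (tens_assoc_at w).
Proof.
split=> [v c u u'|u c v v']; rewrite /tens_assoc_at; first by rewrite linearPl.
by rewrite linearPl linearPr.
Qed.

Definition tens_assoc (t : tensor U V) (w : W) : tensor U (tensor V W) :=
  tlift (tens_assoc_at_bilinear w) t.

Lemma tens_assoc_bilinear : bilinear_for *:%R *:%R tens_assoc.
Proof.
split=> [w c s t|t c w w']; rewrite /= /tens_assoc; first exact: linearP.
elim/tensor_ind: t => [|a u v t IH]; first by rewrite !linear0 addr0.
rewrite !tlift_linear IH !tlift_tens /tens_assoc_at !linearPr.
exact: linear_exchange.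
Qed.

Definition tassoc : tensor (tensor U V) W -> tensor U (tensor V W) :=
  tlift tens_assoc_bilinear.

Lemma tassoc_linear : linear tassoc.
Proof. exact: tlift_linear. Qed.

HB.instance Definition _ := GRing.isLinear.Build K
  (tensor (tensor U V) W) (tensor U (tensor V W)) *:%R tassoc tassoc_linear.

Lemma tassocE u v w : tassoc ((u \ox v) \ox w) = u \ox (v \ox w).
Proof. by rewrite /tassoc /= tlift_tens /tens_assoc tlift_tens. Qed.

Definition tens_unassoc_at (u : U) (v : V) (w : W) : tensor (tensor U V) W :=
  (u \ox v) \ox w.

Lemma tens_unassoc_at_bilinear u : bilinear_for *:%R *:%R (tens_unassoc_at u).
Proof.
split=> [w c v v'|v c w w']; rewrite /tens_unassoc_at; last by rewrite linearPr.
by rewrite linearPr linearPl.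
Qed.

Definition tens_unassoc (u : U) (t : tensor V W) : tensor (tensor U V) W :=
  tlift (tens_unassoc_at_bilinear u) t.

Lemma tens_unassoc_bilinear : bilinear_for *:%R *:%R tens_unassoc.
Proof.
split=> [t c u u'|u c s t]; rewrite /= /tens_unassoc; last exact: linearP.
elim/tensor_ind: t => [|a v w t IH]; first by rewrite !linear0 addr0.
rewrite !tlift_linear IH !tlift_tens /tens_unassoc_at !linearPl.
exact: linear_exchange.
Qed.

Definition tunassoc : tensor U (tensor V W) -> tensor (tensor U V) W :=
  tlift tens_unassoc_bilinear.

Lemma tunassoc_linear : linear tunassoc.
Proof. exact: tlift_linear. Qed.

HB.instance Definition _ := GRing.isLinear.Build K
  (tensor U (tensor V W)) (tensor (tensor U V) W) *:%R tunassoc tunassoc_linear.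

Lemma tunassocE u v w : tunassoc (u \ox (v \ox w)) = (u \ox v) \ox w.
Proof. by rewrite /tunassoc /= tlift_tens /tens_unassoc tlift_tens. Qed.

Lemma tensor_extl (X : lmodType K)
    (g h : {linear tensor (tensor U V) W -> X}) :
  (forall u v w, g ((u \ox v) \ox w) = h ((u \ox v) \ox w)) -> g =1 h.
Proof.
move=> gh; apply: tensor_ext => t w.
elim/tensor_ind: t => [|c u v t IH]; first by rewrite linear0l !linear0.
by rewrite linearPl [LHS]linearP [RHS]linearP gh IH.
Qed.

Lemma tensor_extr (X : lmodType K)
    (g h : {linear tensor U (tensor V W) -> X}) :
  (forall u v w, g (u \ox (v \ox w)) = h (u \ox (v \ox w))) -> g =1 h.
Proof.
move=> gh; apply: tensor_ext => u t.
elim/tensor_ind: t => [|c v w t IH]; first by rewrite linear0r !linear0.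
by rewrite linearPr [LHS]linearP [RHS]linearP gh IH.
Qed.

Lemma tassocK : cancel tassoc tunassoc.
Proof.
apply: (@tensor_extl _ (tunassoc \o tassoc) idfun) => u v w /=.
by rewrite tassocE tunassocE.
Qed.

Lemma tunassocK : cancel tunassoc tassoc.
Proof.
apply: (@tensor_extr _ (tassoc \o tunassoc) idfun) => u v w /=.
by rewrite tunassocE tassocE.
Qed.

End Assoc.

End TensorMaps.

Arguments tassoc {K U V W}.
Arguments tunassoc {K U V W}.

HB.mixin Record Lmodule_isNuAlgebra (K : fieldType) A of GRing.Lmodule K A := {
  numul : A -> A -> A;
  numulA : associative numul;
  numul_bilinear : bilinear_for *:%R *:%R numul
}.

#[short(type="nuAlgType")]
HB.structure Definition NuAlgebra (K : fieldType) :=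
  {A of GRing.Lmodule K A & Lmodule_isNuAlgebra K A}.

Notation "a ** b" := (numul a b) : ring_scope.

HB.instance Definition _ (K : fieldType) (A : nuAlgType K) :=
  bilinear_isBilinear.Build K A A A *:%R *:%R (@numul K A) (@numul_bilinear K A).

HB.instance Definition _ (K : fieldType) (A : nuAlgType K) (a : A) :=
  GRing.isLinear.Build K A A *:%R (numul a) (numul_bilinear.2 a).

Definition nondegenerate_alg (K : fieldType) (A : nuAlgType K) : Prop :=
  (forall a : A, (forall b, a ** b = 0) -> a = 0) /\
  (forall b : A, (forall a, a ** b = 0) -> b = 0).

Lemma numulDZl (K : fieldType) (A : nuAlgType K) c (a a' b : A) :
  (c *: a + a') ** b = c *: (a ** b) + a' ** b.
Proof. exact: (numul_bilinear.1 b c a a'). Qed.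

Lemma numulDZr (K : fieldType) (A : nuAlgType K) c (a b b' : A) :
  a ** (c *: b + b') = c *: (a ** b) + a ** b'.
Proof. exact: (numul_bilinear.2 a c b b'). Qed.

Lemma numul0l (K : fieldType) (A : nuAlgType K) (a : A) : 0 ** a = 0.
Proof. exact: linear0l. Qed.

Lemma numul0r (K : fieldType) (A : nuAlgType K) (a : A) : a ** 0 = 0.
Proof. exact: linear0r. Qed.

Section TensorAlgebra.
Variables (K : fieldType) (A B : nuAlgType K).

Definition tens_mul_at (y : tensor A B) (a : A) (b : B) : tensor A B :=
  tmap (numul a) (numul b) y.

Lemma tens_mul_at_bilinear y : bilinear_for *:%R *:%R (tens_mul_at y).
Proof.
split=> [b c a a'|a c b b']; rewrite /= /tens_mul_at.
  elim/tensor_ind: y => [|e u v t IH]; first by rewrite !linear0 addr0.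
  rewrite !tmap_linear IH !tmapE /= numulDZl linearPl.
  exact: linear_exchange.
elim/tensor_ind: y => [|e u v t IH]; first by rewrite !linear0 addr0.
rewrite !tmap_linear IH !tmapE /= numulDZl linearPr.
exact: linear_exchange.
Qed.

Fact tmul_key : unit. Proof. by []. Qed.

Definition tmul : tensor A B -> tensor A B -> tensor A B :=
  locked_with tmul_key (fun x y => tlift (tens_mul_at_bilinear y) x).

Lemma tmulE x y : tmul x y = tlift (tens_mul_at_bilinear y) x.
Proof. by rewrite /tmul locked_withE. Qed.

Lemma tmul_tens a b c d : tmul (a \ox b) (c \ox d) = (a ** c) \ox (b ** d).
Proof. by rewrite tmulE tlift_tens /tens_mul_at tmapE. Qed.

Lemma tmul_bilinear : bilinear_for *:%R *:%R tmul.
Proof.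
split=> [y c s t|x c s t] /=; rewrite !tmulE; first exact: tlift_linear.
 elim/tensor_ind: x => [|e a b x IH].
  by rewrite !linear0 addr0.
rewrite !tlift_linear IH !tlift_tens /tens_mul_at tmap_linear.
exact: linear_exchange.
Qed.

Lemma tmul_linearl c s t y : tmul (c *: s + t) y = c *: tmul s y + tmul t y.
Proof. exact: (tmul_bilinear.1 y c s t). Qed.

Lemma tmul_linearr c x s t : tmul x (c *: s + t) = c *: tmul x s + tmul x t.
Proof. exact: (tmul_bilinear.2 x c s t). Qed.

Lemma tmul0l y : tmul 0 y = 0.
Proof. by rewrite tmulE linear0. Qed.

Lemma tmul0r x : tmul x 0 = 0.
Proof.
by have := tmul_linearr (-1) x 0 0; rewrite scaler0 addr0 scaleN1r addNr.
Qed.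

Lemma tmulA : associative tmul.
Proof.
move=> x y z; elim/tensor_ind: x => [|e a b x IHx]; first by rewrite !tmul0l.
rewrite !tmul_linearl IHx; congr (_ *: _ + _) => {IHx}.
elim/tensor_ind: y => [|f c d y IHy]; first by rewrite !(tmul0l, tmul0r).
rewrite tmul_linearl !tmul_linearr IHy tmul_linearl; congr (_ *: _ + _) => {IHy}.
elim/tensor_ind: z => [|g u v z IHz]; first by rewrite !tmul0r.
by rewrite !tmul_linearr IHz !tmul_tens !numulA.
Qed.

HB.instance Definition _ := Lmodule_isNuAlgebra.Build K (tensor A B)
  tmulA tmul_bilinear.

Lemma tens_mulE (a c : A) (b d : B) :
  (a \ox b) ** (c \ox d) = (a ** c) \ox (b ** d).
Proof. exact: tmul_tens. Qed.

End TensorAlgebra.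

(* Double centralizers realize [M(A)]: [lmult m a] is the product [m a] and
   [rmult m a] is the product [a m]. *)
Record multiplier (K : fieldType) (A : nuAlgType K) := Multiplier {
  lmult : A -> A;
  rmult : A -> A;
  lmult_linear : linear lmult;
  rmult_linear : linear rmult;
  lmultM : forall a b, lmult (a ** b) = lmult a ** b;
  rmultM : forall a b, rmult (a ** b) = a ** rmult b;
  multC : forall a b, a ** lmult b = rmult a ** b
}.

Section Multiplier.
Variables (K : fieldType) (A : nuAlgType K).
Implicit Types m n : multiplier A.

HB.instance Definition _ := gen_eqMixin (multiplier A).
HB.instance Definition _ := gen_choiceMixin (multiplier A).

HB.instance Definition _ m :=
  GRing.isLinear.Build K A A *:%R (lmult m) (lmult_linear m).
HB.instance Definition _ m :=
  GRing.isLinear.Build K A A *:%R (rmult m) (rmult_linear m).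

Lemma multiplier_ext m n :
  lmult m =1 lmult n -> rmult m =1 rmult n -> m = n.
Proof.
case: m n => [l r ? ? ? ? ?] [l' r' ? ? ? ? ?] /= /funext ll' /funext rr'.
by subst l' r'; congr Multiplier; exact: Prop_irrelevance.
Qed.

Program Definition mult0 : multiplier A :=
  @Multiplier K A (fun=> 0) (fun=> 0) _ _ _ _ _.
Next Obligation. by move=> c a b; rewrite scaler0 addr0. Qed.
Next Obligation. by move=> c a b; rewrite scaler0 addr0. Qed.
Next Obligation. by rewrite linear0l. Qed.
Next Obligation. by rewrite linear0r. Qed.
Next Obligation. by rewrite linear0r linear0l. Qed.

Program Definition mult_opp m : multiplier A :=
  @Multiplier K A (fun a => - lmult m a) (fun a => - rmult m a) _ _ _ _ _.
Next Obligation. by move=> c a b; rewrite linearP opprD scalerN. Qed.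
Next Obligation. by move=> c a b; rewrite linearP opprD scalerN. Qed.
Next Obligation. by rewrite linearNl /= lmultM. Qed.
Next Obligation. by rewrite linearNr /= rmultM. Qed.
Next Obligation. by rewrite linearNl linearNr /= multC. Qed.

Program Definition mult_add m n : multiplier A :=
  @Multiplier K A (fun a => lmult m a + lmult n a)
                  (fun a => rmult m a + rmult n a) _ _ _ _ _.
Next Obligation. by move=> c a b; rewrite !linearP scalerDr addrACA. Qed.
Next Obligation. by move=> c a b; rewrite !linearP scalerDr addrACA. Qed.
Next Obligation. by rewrite linearDl /= !lmultM. Qed.
Next Obligation. by rewrite linearDr /= !rmultM. Qed.
Next Obligation. by rewrite linearDl linearDr /= !multC. Qed.

Program Definition mult_scale c m : multiplier A :=
  @Multiplier K A (fun a => c *: lmult m a) (fun a => c *: rmult m a) _ _ _ _ _.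
Next Obligation.
by move=> e a b; rewrite linearP scalerDr !scalerA mulrC.
Qed.
Next Obligation.
by move=> e a b; rewrite linearP scalerDr !scalerA mulrC.
Qed.
Next Obligation. by rewrite linearZl_LR /= lmultM. Qed.
Next Obligation. by rewrite linearZr_LR /= rmultM. Qed.
Next Obligation. by rewrite linearZl_LR linearZr_LR /= multC. Qed.

Program Definition mult1 : multiplier A :=
  @Multiplier K A id id _ _ _ _ _.
Solve Obligations with by move=> *.

Program Definition mult_mul m n : multiplier A :=
  @Multiplier K A (fun a => lmult m (lmult n a))
                  (fun a => rmult n (rmult m a)) _ _ _ _ _.
Next Obligation. by move=> c a b; rewrite !linearP. Qed.
Next Obligation. by move=> c a b; rewrite !linearP. Qed.
Next Obligation. by rewrite !lmultM. Qed.
Next Obligation. by rewrite !rmultM. Qed.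
Next Obligation. by rewrite !multC. Qed.

Lemma mult_addA : associative mult_add.
Proof. by move=> l m n; apply: multiplier_ext => a /=; rewrite addrA. Qed.
Lemma mult_addC : commutative mult_add.
Proof. by move=> m n; apply: multiplier_ext => a /=; rewrite addrC. Qed.
Lemma mult_add0 : left_id mult0 mult_add.
Proof. by move=> m; apply: multiplier_ext => a /=; rewrite add0r. Qed.
Lemma mult_addN : left_inverse mult0 mult_opp mult_add.
Proof. by move=> m; apply: multiplier_ext => a /=; rewrite addNr. Qed.

HB.instance Definition _ := GRing.isZmodule.Build (multiplier A)
  mult_addA mult_addC mult_add0 mult_addN.

Lemma mult_scaleA a b m : mult_scale a (mult_scale b m) = mult_scale (a * b) m.
Proof. by apply: multiplier_ext => x /=; rewrite scalerA. Qed.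
Lemma mult_scale1 : left_id 1 mult_scale.
Proof. by move=> m; apply: multiplier_ext => x /=; rewrite scale1r. Qed.
Lemma mult_scaleDr : right_distributive mult_scale +%R.
Proof. by move=> a m n; apply: multiplier_ext => x /=; rewrite scalerDr. Qed.
Lemma mult_scaleDl m : {morph mult_scale^~ m : a b / a + b}.
Proof. by move=> a b; apply: multiplier_ext => x /=; rewrite scalerDl. Qed.

HB.instance Definition _ := GRing.Zmodule_isLmodule.Build K (multiplier A)
  mult_scaleA mult_scale1 mult_scaleDr mult_scaleDl.

Lemma mult_mulA : associative mult_mul.
Proof. by move=> l m n; apply: multiplier_ext. Qed.
Lemma mult_mul1 : left_id mult1 mult_mul.
Proof. by move=> m; apply: multiplier_ext. Qed.
Lemma mult_1mul : right_id mult1 mult_mul.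
Proof. by move=> m; apply: multiplier_ext. Qed.
Lemma mult_mulDl : left_distributive mult_mul +%R.
Proof. by move=> l m n; apply: multiplier_ext => a //=; rewrite linearD. Qed.
Lemma mult_mulDr : right_distributive mult_mul +%R.
Proof. by move=> l m n; apply: multiplier_ext => a //=; rewrite linearD. Qed.

HB.instance Definition _ := GRing.Zmodule_isPzRing.Build (multiplier A)
  mult_mulA mult_mul1 mult_1mul mult_mulDl mult_mulDr.

Lemma mult_scaleAl c m n : c *: (m * n) = (c *: m) * n.
Proof. by apply: multiplier_ext => a //=; rewrite linearZ. Qed.
Lemma mult_scaleAr c m n : c *: (m * n) = m * (c *: n).
Proof. by apply: multiplier_ext => a //=; rewrite linearZ. Qed.

(* [A] as an ideal of [M(A)]; see [mincl_ideall], [mincl_idealr], [mincl_inj]. *)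
Program Definition mincl (x : A) : multiplier A :=
  @Multiplier K A (fun a => x ** a) (fun a => a ** x) _ _ _ _ _.
Next Obligation. by move=> c a b; rewrite numulDZr. Qed.
Next Obligation. by move=> c a b; rewrite numulDZl. Qed.
Next Obligation. by rewrite numulA. Qed.
Next Obligation. by rewrite numulA. Qed.
Next Obligation. by rewrite numulA. Qed.

Lemma mincl_linear : linear mincl.
Proof.
by move=> c x y; apply: multiplier_ext => a /=; rewrite (numulDZl, numulDZr).
Qed.

HB.instance Definition _ :=
  GRing.isLinear.Build K A (multiplier A) *:%R mincl mincl_linear.

Lemma minclM x y : mincl (x ** y) = mincl x * mincl y.
Proof. by apply: multiplier_ext => a /=; rewrite numulA. Qed.

Lemma mincl_ideall m x : m * mincl x = mincl (lmult m x).
Proof. by apply: multiplier_ext => a /=; rewrite ?lmultM ?multC. Qed.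

Lemma mincl_idealr m x : mincl x * m = mincl (rmult m x).
Proof. by apply: multiplier_ext => a /=; rewrite ?rmultM ?multC. Qed.

Lemma mincl_inj : nondegenerate_alg A -> injective mincl.
Proof.
move=> [ndl _] x y [/(congr1 (fun f => f _)) xy _].
apply/eqP; rewrite -subr_eq0; apply/eqP/ndl => b.
by rewrite linearBl /= (xy b) subrr.
Qed.

End Multiplier.

Section MultiplierTensor.
Variables (K : fieldType) (A B : nuAlgType K).

Lemma tmap_mull (f : {linear A -> A}) (g : {linear B -> B})
    (x y : tensor A B) :
  (forall a b, f (a ** b) = f a ** b) -> (forall a b, g (a ** b) = g a ** b) ->
  tmap f g (x ** y) = tmap f g x ** y.
Proof.
move=> fM gM; elim/tensor_ind: x => [|e a b x IHx].
  by rewrite numul0l linear0 numul0l.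
rewrite tmap_linear !numulDZl tmap_linear IHx; congr (_ *: _ + _) => {IHx x}.
elim/tensor_ind: y => [|e' c d y IHy]; first by rewrite !numul0r linear0.
rewrite !numulDZr tmap_linear IHy; congr (_ *: _ + _).
by rewrite tens_mulE !tmapE tens_mulE fM gM.
Qed.

Lemma tmap_mulr (f : {linear A -> A}) (g : {linear B -> B})
    (x y : tensor A B) :
  (forall a b, f (a ** b) = a ** f b) -> (forall a b, g (a ** b) = a ** g b) ->
  tmap f g (x ** y) = x ** tmap f g y.
Proof.
move=> fM gM; elim/tensor_ind: x => [|e a b x IHx].
  by rewrite !numul0l linear0.
rewrite !numulDZl tmap_linear IHx; congr (_ *: _ + _) => {IHx x}.
elim/tensor_ind: y => [|e' c d y IHy].
  by rewrite numul0r linear0 numul0r.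
rewrite tmap_linear !numulDZr tmap_linear IHy; congr (_ *: _ + _).
by rewrite tens_mulE !tmapE tens_mulE fM gM.
Qed.

Lemma tmap_mulC (f f' : {linear A -> A}) (g g' : {linear B -> B})
    (x y : tensor A B) :
  (forall a b, a ** f b = f' a ** b) -> (forall a b, a ** g b = g' a ** b) ->
  x ** tmap f g y = tmap f' g' x ** y.
Proof.
move=> fM gM; elim/tensor_ind: x => [|e a b x IHx].
  by rewrite numul0l linear0 numul0l.
rewrite tmap_linear !numulDZl IHx; congr (_ *: _ + _) => {IHx x}.
elim/tensor_ind: y => [|e' c d y IHy].
  by rewrite linear0 !numul0r.
rewrite tmap_linear !numulDZr IHy; congr (_ *: _ + _).
by rewrite !tmapE !tens_mulE fM gM.
Qed.

(* The embedding of [M(A) \ox M(B)] in [M(A \ox B)], on pure tensors. *)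
Definition mtens (m : multiplier A) (n : multiplier B) :
    multiplier (tensor A B) :=
  @Multiplier K (tensor A B)
    (tmap (lmult m) (lmult n)) (tmap (rmult m) (rmult n))
    (tmap_linear (lmult m) (lmult n)) (tmap_linear (rmult m) (rmult n))
    (fun x y => tmap_mull x y (lmultM m) (lmultM n))
    (fun x y => tmap_mulr x y (rmultM m) (rmultM n))
    (fun x y => tmap_mulC x y (multC m) (multC n)).

Lemma lmult_mtens m n (x : tensor A B) :
  lmult (mtens m n) x = tmap (lmult m) (lmult n) x.
Proof. by []. Qed.

Lemma rmult_mtens m n (x : tensor A B) :
  rmult (mtens m n) x = tmap (rmult m) (rmult n) x.
Proof. by []. Qed.

Lemma mtens_bilinear : bilinear_for *:%R *:%R mtens.
Proof.
split=> [n c m m'|m c n n'] /=; apply: multiplier_ext => x /=;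
  (elim/tensor_ind: x => [|e a b x IHx]; first by rewrite !linear0 addr0);
  rewrite !tmap_linear IHx !tmapE /= (tensDZl, tensDZr);
  exact: linear_exchange.
Qed.

Lemma mtens_mincl a b : mtens (mincl a) (mincl b) = mincl (a \ox b).
Proof.
apply: multiplier_ext => x /=;
  (elim/tensor_ind: x => [|e c d x IHx];
     first by rewrite linear0 (numul0l, numul0r));
  by rewrite tmap_linear (numulDZl, numulDZr) IHx tmapE /= tens_mulE.
Qed.

Lemma mtensM m m' n n' : mtens (m * m') (n * n') = mtens m n * mtens m' n'.
Proof.
apply: multiplier_ext => x /=;
  (elim/tensor_ind: x => [|e c d x IHx]; first by rewrite !linear0);
  by rewrite !tmap_linear IHx !tmapE.
Qed.

Lemma mtens1 : mtens 1 1 = 1.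
Proof.
apply: multiplier_ext => x /=;
  (elim/tensor_ind: x => [|e c d x IHx]; first by rewrite linear0);
  by rewrite tmap_linear IHx tmapE.
Qed.

End MultiplierTensor.

Section MultiplierAssoc.
Variables (K : fieldType) (A B C : nuAlgType K).

Lemma tassocM (x y : tensor (tensor A B) C) :
  tassoc (x ** y) = tassoc x ** tassoc y.
Proof.
elim/tensor_ind: x => [|e t w x IHx]; first by rewrite numul0l linear0 numul0l.
rewrite numulDZl !tassoc_linear numulDZl IHx; congr (_ *: _ + _) => {IHx x}.
elim/tensor_ind: t => [|e' u v t IHt].
  by rewrite linear0l numul0l linear0 numul0l.
rewrite tensDZl numulDZl !tassoc_linear numulDZl IHt.
congr (_ *: _ + _) => {IHt t}.
elim/tensor_ind: y => [|f t z y IHy]; first by rewrite numul0r linear0 numul0r.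
rewrite numulDZr !tassoc_linear numulDZr IHy; congr (_ *: _ + _) => {IHy y}.
elim/tensor_ind: t => [|f' a b t IHt].
  by rewrite linear0l numul0r linear0 numul0r.
rewrite tensDZl numulDZr !tassoc_linear numulDZr IHt; congr (_ *: _ + _).
by rewrite !tens_mulE !tassocE !tens_mulE.
Qed.

Lemma tunassocM (x y : tensor A (tensor B C)) :
  tunassoc (x ** y) = tunassoc x ** tunassoc y.
Proof.
by rewrite -[in LHS](tunassocK x) -[in LHS](tunassocK y) -tassocM tassocK.
Qed.

(* The identification of [M(A \ox (B \ox C))] with [M((A \ox B) \ox C)]. *)
Program Definition massoc (m : multiplier (tensor A (tensor B C))) :
    multiplier (tensor (tensor A B) C) :=
  @Multiplier K (tensor (tensor A B) C)
    (fun x => tunassoc (lmult m (tassoc x)))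
    (fun x => tunassoc (rmult m (tassoc x))) _ _ _ _ _.
Next Obligation.
by move=> c x y; rewrite tassoc_linear lmult_linear tunassoc_linear.
Qed.
Next Obligation.
by move=> c x y; rewrite tassoc_linear rmult_linear tunassoc_linear.
Qed.
Next Obligation. by rewrite tassocM lmultM tunassocM tassocK. Qed.
Next Obligation. by rewrite tassocM rmultM tunassocM tassocK. Qed.
Next Obligation.
rewrite -[X in X ** _ = _]tassocK -tunassocM multC tunassocM.
by rewrite [tunassoc (tassoc _)]tassocK.
Qed.

Lemma massoc_mtens l m n :
  massoc (mtens l (mtens m n)) = mtens (mtens l m) n.
Proof.
have f (l' : {linear A -> A}) (m' : {linear B -> B})
    (n' : {linear C -> C}) (x : tensor (tensor A B) C) :
    tunassoc (tmap l' (tmap m' n') (tassoc x)) = tmap (tmap l' m') n' x.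
  have h : (tunassoc \o tmap l' (tmap m' n') \o tassoc) =1 tmap (tmap l' m') n'.
    apply: tensor_extl => a b c /=.
    by rewrite tassocE !tmapE /= !tmapE tunassocE.
  exact: h.
by apply: multiplier_ext => x; exact: f.
Qed.

End MultiplierAssoc.

Section MultiplierHopf.
Variables (K : fieldType) (A : nuAlgType K).

Local Notation AA := (tensor A A).
Local Notation AAA := (tensor (tensor A A) A).

Variable Delta : {linear A -> multiplier AA}.

(* [c \ox 1] and [1 \ox b] *)
Definition mleft (c : A) : multiplier AA := mtens (mincl c) 1.
Definition mright (b : A) : multiplier AA := mtens 1 (mincl b).

Lemma mleft_linear : linear mleft.
Proof. by move=> c x y; rewrite /mleft linearP; apply: (mtens_bilinear _ _).1. Qed.

Lemma mright_linear : linear mright.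
Proof. by move=> c x y; rewrite /mright linearP; apply: (mtens_bilinear _ _).2. Qed.

Definition T1_on (a b : A) : multiplier AA := Delta a * mright b.
Definition T2_on (c a : A) : multiplier AA := mleft c * Delta a.
Definition T3_on (a b : A) : multiplier AA := mright b * Delta a.
Definition T4_on (c a : A) : multiplier AA := Delta a * mleft c.

Lemma T1_on_bilinear : bilinear_for *:%R *:%R T1_on.
Proof.
split=> [b c a a'|a c b b'] /=; rewrite /T1_on.
  by rewrite linearP mulrDl -mult_scaleAl.
by rewrite mright_linear mulrDr -mult_scaleAr.
Qed.

Lemma T2_on_bilinear : bilinear_for *:%R *:%R T2_on.
Proof.
split=> [b c a a'|a c b b'] /=; rewrite /T2_on.
  by rewrite mleft_linear mulrDl -mult_scaleAl.
by rewrite linearP mulrDr -mult_scaleAr.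
Qed.

Lemma T3_on_bilinear : bilinear_for *:%R *:%R T3_on.
Proof.
split=> [b c a a'|a c b b'] /=; rewrite /T3_on.
  by rewrite linearP mulrDr -mult_scaleAr.
by rewrite mright_linear mulrDl -mult_scaleAl.
Qed.

Lemma T4_on_bilinear : bilinear_for *:%R *:%R T4_on.
Proof.
split=> [b c a a'|a c b b'] /=; rewrite /T4_on.
  by rewrite mleft_linear mulrDr -mult_scaleAr.
by rewrite linearP mulrDl -mult_scaleAl.
Qed.

Definition T1 : AA -> multiplier AA := tlift T1_on_bilinear.
HB.instance Definition _ :=
  GRing.isLinear.Build K AA (multiplier AA) *:%R T1 (tlift_linear T1_on_bilinear).
Definition T2 : AA -> multiplier AA := tlift T2_on_bilinear.
HB.instance Definition _ :=
  GRing.isLinear.Build K AA (multiplier AA) *:%R T2 (tlift_linear T2_on_bilinear).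
Definition T3 : AA -> multiplier AA := tlift T3_on_bilinear.
HB.instance Definition _ :=
  GRing.isLinear.Build K AA (multiplier AA) *:%R T3 (tlift_linear T3_on_bilinear).
Definition T4 : AA -> multiplier AA := tlift T4_on_bilinear.
HB.instance Definition _ :=
  GRing.isLinear.Build K AA (multiplier AA) *:%R T4 (tlift_linear T4_on_bilinear).

(* [Delta \ox iota] and [iota \ox Delta] are defined on [A \ox A] only. *)
Definition Delta_iota_on (a b : A) : multiplier AAA := mtens (Delta a) (mincl b).

Lemma Delta_iota_on_bilinear : bilinear_for *:%R *:%R Delta_iota_on.
Proof.
split=> [b c a a'|a c b b'] /=; rewrite /Delta_iota_on linearP.
  exact: (mtens_bilinear _ _).1.
exact: (mtens_bilinear _ _).2.
Qed.

Definition Delta_iota : AA -> multiplier AAA := tlift Delta_iota_on_bilinear.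
HB.instance Definition _ := GRing.isLinear.Build K AA (multiplier AAA) *:%R
  Delta_iota (tlift_linear Delta_iota_on_bilinear).

Definition iota_Delta_on (a b : A) : multiplier (tensor A (tensor A A)) :=
  mtens (mincl a) (Delta b).

Lemma iota_Delta_on_bilinear : bilinear_for *:%R *:%R iota_Delta_on.
Proof.
split=> [b c a a'|a c b b'] /=; rewrite /iota_Delta_on linearP.
  exact: (mtens_bilinear _ _).1.
exact: (mtens_bilinear _ _).2.
Qed.

Definition iota_Delta : AA -> multiplier (tensor A (tensor A A)) :=
  tlift iota_Delta_on_bilinear.
HB.instance Definition _ :=
  GRing.isLinear.Build K AA (multiplier (tensor A (tensor A A))) *:%R
    iota_Delta (tlift_linear iota_Delta_on_bilinear).

Lemma T1E a b : T1 (a \ox b) = Delta a * mright b.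
Proof. exact: tlift_tens. Qed.
Lemma T2E c a : T2 (c \ox a) = mleft c * Delta a.
Proof. exact: tlift_tens. Qed.
Lemma T3E a b : T3 (a \ox b) = mright b * Delta a.
Proof. exact: tlift_tens. Qed.
Lemma T4E c a : T4 (c \ox a) = Delta a * mleft c.
Proof. exact: tlift_tens. Qed.

Lemma Delta_iotaE a b : Delta_iota (a \ox b) = mtens (Delta a) (mincl b).
Proof. exact: tlift_tens. Qed.
Lemma iota_DeltaE a b : iota_Delta (a \ox b) = mtens (mincl a) (Delta b).
Proof. exact: tlift_tens. Qed.

Definition regular_map (T : AA -> multiplier AA) : Prop :=
  forall x, exists y : AA, T x = mincl y.

(* The range lies in [A \ox A] and the map [A \ox A -> A \ox A] so obtained is
   bijective. *)
Definition bijective_on_tensor (T : AA -> multiplier AA) : Prop :=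
  exists2 t : AA -> AA, (forall x, T x = mincl (t x)) & bijective t.

(* [Delta \ox iota] and [iota \ox Delta] apply to the elements [x], [y] of
   [A \ox A] that are [Delta(a)(1 \ox b)] and [Delta(a)(c \ox 1)]; these exist
   by regularity of [T1] and [T4], and are unique when [A] is non-degenerate. *)
Definition left_coassociative : Prop :=
  forall (a b c : A) (x y : AA),
    Delta a * mright b = mincl x -> Delta a * mleft c = mincl y ->
    Delta_iota x * mtens (mtens (mincl c) 1) 1
    = massoc (iota_Delta y) * mtens (mtens 1 1) (mincl b).

(* Likewise, with [x = Delta(a)(1 \ox b)] and [y = (c \ox 1)Delta(a)]. *)
Definition coassociative : Prop :=
  forall (a b c : A) (x y : AA),
    Delta a * mright b = mincl x -> mleft c * Delta a = mincl y ->
    mtens (mtens (mincl c) 1) 1 * Delta_iota x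
    = massoc (iota_Delta y) * mtens (mtens 1 1) (mincl b).

Definition left_multiplier_hopf : Prop :=
  [/\ regular_map T1 /\ regular_map T4, left_coassociative,
      bijective_on_tensor T1 & bijective_on_tensor T4].

Definition multiplier_hopf : Prop :=
  [/\ regular_map T1 /\ regular_map T2, coassociative,
      bijective_on_tensor T1 & bijective_on_tensor T2].

Definition regular_multiplier_hopf : Prop :=
  [/\ multiplier_hopf,
      [/\ regular_map T1, regular_map T2, regular_map T3 & regular_map T4] &
      [/\ bijective_on_tensor T1, bijective_on_tensor T2,
          bijective_on_tensor T3 & bijective_on_tensor T4]].

End MultiplierHopf.

(* Main.v *)
From HB Require Import structures.
Require Import Defs.
From mathcomp Require Import all_boot all_algebra.
From mathcomp Require Import boolp classical_sets reals complex.

(* Write [T1] and [T4] as bijections [F : a \ox b |-> a_(1) \ox a_(2) b] and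
   [G : a \ox c |-> a_(2) \ox a_(1) c] of [A \ox A]; coassociativity says that
   [F] on legs 1, 2 commutes with [G] on legs 1, 3, and the flip exchanges [F]
   and [G].  Comparing [F^-1] with [G] gives a counit with
   [m (F^-1 (a \ox b)) = eps(a) b = m (G^-1 (a \ox b))].  Then
   [S(a) b = (eps \ox iota) (F^-1 (a \ox b))] defines [S(a)] a priori only as a
   left multiplier, but [S(c) eps(d) = S(d_(1) c) d_(2)] with
   [d_(1) c \ox d_(2)] in [A \ox A] shows that [S(c)] lies in [A].  The same
   construction with [F] and [G] exchanged gives the inverse of [S].  Finally
   [S(c) a_(1) \ox a_(2)] is the image of [c \ox a] under
   [(S \ox iota) T4^-1], so [T2 = (S \ox iota) T4^-1 (S^-1 \ox iota)] is a
   bijection of [A \ox A], and likewise [T3] by symmetry. *)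

Set Implicit Arguments.
Unset Strict Implicit.
Unset Printing Implicit Defensive.

Import GRing.Theory.
Local Open Scope classical_set_scope.
Local Open Scope ring_scope.

Section Separation.
Variable K : fieldType.

Lemma scalar_fun (V : lmodType K) (f : V -> K) :
  scalar f -> exists g : {scalar V}, g =1 f.
Proof.
by move=> fL; exists (HB.pack_for {scalar V} f (GRing.isLinear.Build K V K *%R f fL)).
Qed.

Lemma scalar_neq0 (V : lmodType K) (x : V) :
  x != 0 -> exists f : {scalar V}, f x = 1.
Proof.
move=> x0.
pose P (W : set V) := ~ W x /\ forall c u v, W u -> W v -> W (c *: u + v).
have [W [[Wx WD] Wmax]] : exists W, P W /\ forall B, W `<` B -> ~ P B.
  apply: Zorn_bigcup => F FP Ftot; split=> [[W FW]|c u v [W FW Wu] [W' FW' W'v]].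
    exact: (FP W FW).1.
  case: (Ftot W W' FW FW') => WW'.
    by exists W' => //; apply: (FP W' FW').2 => //; exact: WW'.
  by exists W => //; apply: (FP W FW).2 => //; exact: WW'.
have W0 : W 0.
  have [[w Ww]|Wno] := pselect (exists w, W w).
    by have := WD (-1) w w Ww Ww; rewrite scaleN1r addNr.
  case: (Wmax [set 0]%classic).
    split=> [u Wu|eW]; last by apply: Wno; exists 0; exact: eW.
    by case: Wno; exists u.
  by split=> [/= e|c u v /= -> ->]; [rewrite e eqxx in x0 | rewrite scaler0 addr0].
have WZ c u : W u -> W (c *: u) by move=> Wu; rewrite -[_ *: _]addr0; exact: WD.
have WP y : exists l, W (y - l *: x).
  have [Wy|Wy] := pselect (W y); first by exists 0; rewrite scale0r subr0.
  pose W' := [set z | exists w m, W w /\ z = w + m *: y]%classic.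
  have [[w [m [Ww ex]]]|W'x] := pselect (W' x).
    have m0 : m != 0.
      by apply: contra_notN Wx => /eqP m0; rewrite ex m0 scale0r addr0.
    exists m^-1; rewrite ex scalerDr scalerA mulVf // scale1r opprD addrCA subrr.
    by rewrite addr0 -scaleNr; exact: WZ.
  case: (Wmax W').
    split=> [w Ww|eW]; last by apply: Wy; apply: eW; exists 0, 1; rewrite scale1r add0r.
    by exists w, 0; rewrite scale0r addr0.
  split=> // c _ _ [u [m [Wu ->]]] [v [n [Wv ->]]].
  exists (c *: u + v), (c * m + n); split; first exact: WD.
  by rewrite scalerDr scalerDl scalerA addrACA.
have [f fP] := boolp.choice WP.
have fE y l : W (y - l *: x) -> f y = l.
  move=> Wy; apply/eqP; apply: contra_notT Wx; rewrite -subr_eq0 => fl.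
  have := WZ (f y - l)^-1 _ (WD (-1) _ _ (fP y) Wy).
  rewrite scaleN1r opprB addrA subrK -[- (l *: x)]scaleNr.
  by rewrite -scalerDl scalerA mulVf // scale1r.
have /scalar_fun[g gf] : scalar f.
  move=> c u v; apply: fE; rewrite /= scalerDl -scalerA opprD addrACA -scalerBr.
  exact: WD.
by exists g; rewrite gf; apply: fE; rewrite scale1r subrr.
Qed.

Section Slice.
Variables U V : lmodType K.

Lemma tensor_sum (t : tensor U V) :
  exists s : seq (U * V), t = \sum_(p <- s) p.1 \ox p.2.
Proof.
elim/tensor_ind: t => [|c u v t [s ->]]; first by exists [::]; rewrite big_nil.
by exists ((c *: u, v) :: s); rewrite big_cons /= linearZl_LR.
Qed.

Definition slice_on (f : {scalar V}) (u : U) (v : V) : U := f v *: u.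

Lemma slice_on_bilinear f : bilinear_for *:%R *:%R (slice_on f).
Proof.
split=> [v c u u'|u c v v'] /=; rewrite /slice_on.
  by rewrite scalerDr !scalerA mulrC.
by rewrite linearP scalerDl scalerA.
Qed.

Definition slice (f : {scalar V}) : tensor U V -> U := tlift (slice_on_bilinear f).

HB.instance Definition _ (f : {scalar V}) :=
  GRing.isLinear.Build K (tensor U V) U *:%R (slice f)
    (tlift_linear (slice_on_bilinear f)).

Lemma sliceE f u v : slice f (u \ox v) = f v *: u.
Proof. exact: tlift_tens. Qed.

(* A functional not vanishing on the right leg of one summand expresses its
   left leg through the others, which shortens the sum. *)
Lemma slice_eq0 (t : tensor U V) : (forall f, slice f t = 0) -> t = 0.
Proof.
have [s ->] := tensor_sum t; have [n] := ubnP (size s).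
elim: n s => // n IHn [|[u v] s]; first by rewrite big_nil.
rewrite ltnS big_cons /= => ltsn s0.
have [v0|/scalar_neq0[f fv]] := eqVneq v 0.
  rewrite v0 linear0r add0r; apply: IHn => // f.
  by have := s0 f; rewrite v0 linear0r add0r.
have uE : u = - \sum_(p <- s) f p.2 *: p.1.
  apply/eqP; rewrite -addr_eq0; apply/eqP.
  have := s0 f; rewrite linearD linear_sum /= sliceE fv scale1r => e.
  by rewrite -[RHS]e; congr (_ + _); apply: eq_bigr => p _; rewrite /= sliceE.
have tE : u \ox v + \sum_(p <- s) p.1 \ox p.2 =
    \sum_(p <- [seq (p.1, p.2 - f p.2 *: v) | p <- s]) p.1 \ox p.2.
  rewrite big_map /= uE linearNl linear_sumlz /= addrC -sumrB.
  by apply: eq_bigr => p _; rewrite linearBr linearZl_LR linearZr_LR.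
rewrite tE; apply: IHn; first by rewrite size_map.
by move=> g; rewrite -tE.
Qed.

Lemma tens_neq0 u v : u != 0 -> v != 0 -> u \ox v != 0 :> tensor U V.
Proof.
move=> u0 /scalar_neq0[f fv]; apply: contraNneq u0 => /(congr1 (slice f)).
by rewrite sliceE fv scale1r linear0 => ->.
Qed.

End Slice.

Section Swap.
Variables U V : lmodType K.

Definition tswap_on (u : U) (v : V) : tensor V U := v \ox u.

Lemma tswap_on_bilinear : bilinear_for *:%R *:%R tswap_on.
Proof.
by split=> [v c u u'|u c v v'] /=; rewrite /tswap_on (tensDZl, tensDZr).
Qed.

Definition tswap : tensor U V -> tensor V U := tlift tswap_on_bilinear.

Lemma tswap_linear : linear tswap.
Proof. exact: tlift_linear. Qed.

HB.instance Definition _ :=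
  GRing.isLinear.Build K (tensor U V) (tensor V U) *:%R tswap tswap_linear.

Lemma tswapE u v : tswap (u \ox v) = v \ox u.
Proof. exact: tlift_tens. Qed.

End Swap.

Lemma tswapK (U V : lmodType K) : cancel (@tswap U V) (@tswap V U).
Proof.
apply: (@tensor_ext _ _ _ _ (@tswap V U \o @tswap U V) idfun) => u v /=.
by rewrite !tswapE.
Qed.

End Separation.

Section Nondegenerate.
Variable K : fieldType.

Lemma tmap_eq0 (I : Type) (U U' V : lmodType K) (f : I -> {linear U -> U'})
    (g : {linear V -> V}) (t : tensor U V) :
  (forall u, (forall i, f i u = 0) -> u = 0) -> g =1 id ->
  (forall i, tmap (f i) g t = 0) -> t = 0.
Proof.
move=> f0 gE t0; apply: slice_eq0 => h; apply: f0 => i.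
have <- : slice h (tmap (f i) g t) = f i (slice h t).
  apply: (@tensor_ext _ _ _ _ (slice h \o tmap (f i) g) (f i \o slice h)) => u v /=.
  by rewrite tmapE /= !sliceE linearZ gE.
by rewrite t0 linear0.
Qed.

Lemma rmult_mleft_eq0 (A B : nuAlgType K) (t : tensor A B) :
  nondegenerate_alg A ->
  (forall a, rmult (mtens (mincl a) 1) t = 0) -> t = 0.
Proof.
move=> [ndl _] t0; apply: (@tmap_eq0 A A A B (fun a => rmult (mincl a)) (rmult 1)).
- exact: ndl.
- by [].
- exact: t0.
Qed.

Lemma lmult_mleft_eq0 (A B : nuAlgType K) (t : tensor A B) :
  nondegenerate_alg A ->
  (forall a, lmult (mtens (mincl a) 1) t = 0) -> t = 0.
Proof.
move=> [_ ndr] t0; apply: (@tmap_eq0 A A A B (fun a => lmult (mincl a)) (lmult 1)).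
- exact: ndr.
- by [].
- exact: t0.
Qed.

Lemma tswap_rmult (A B : nuAlgType K) (m : multiplier A) (n : multiplier B)
    (t : tensor A B) :
  tswap (rmult (mtens m n) t) = rmult (mtens n m) (tswap t).
Proof.
apply: (@tensor_ext _ _ _ _ (@tswap _ A B \o rmult (mtens m n))
  (rmult (mtens n m) \o @tswap _ A B)) => a b /=.
by rewrite tmapE !tswapE tmapE.
Qed.

Lemma tswap_lmult (A B : nuAlgType K) (m : multiplier A) (n : multiplier B)
    (t : tensor A B) :
  tswap (lmult (mtens m n) t) = lmult (mtens n m) (tswap t).
Proof.
apply: (@tensor_ext _ _ _ _ (@tswap _ A B \o lmult (mtens m n))
  (lmult (mtens n m) \o @tswap _ A B)) => a b /=.
by rewrite tmapE !tswapE tmapE.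
Qed.

Lemma rmult_mright_eq0 (A B : nuAlgType K) (t : tensor A B) :
  nondegenerate_alg B ->
  (forall b, rmult (mtens 1 (mincl b)) t = 0) -> t = 0.
Proof.
move=> ndB t0; rewrite -[t]tswapK; suff -> : tswap t = 0 by rewrite linear0.
by apply: rmult_mleft_eq0 => // b; rewrite -tswap_rmult t0 linear0.
Qed.

Lemma lmult_mright_eq0 (A B : nuAlgType K) (t : tensor A B) :
  nondegenerate_alg B ->
  (forall b, lmult (mtens 1 (mincl b)) t = 0) -> t = 0.
Proof.
move=> ndB t0; rewrite -[t]tswapK; suff -> : tswap t = 0 by rewrite linear0.
by apply: lmult_mleft_eq0 => // b; rewrite -tswap_lmult t0 linear0.
Qed.

Lemma mincl_tens (A B : nuAlgType K) (a : A) (b : B) :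
  mincl (a \ox b) = mtens 1 (mincl b) * mtens (mincl a) 1.
Proof. by rewrite -mtensM mulr1 mul1r mtens_mincl. Qed.

Lemma mincl_tensC (A B : nuAlgType K) (a : A) (b : B) :
  mincl (a \ox b) = mtens (mincl a) 1 * mtens 1 (mincl b).
Proof. by rewrite -mtensM mulr1 mul1r mtens_mincl. Qed.

Lemma tensor_nondegenerate (A B : nuAlgType K) :
  nondegenerate_alg A -> nondegenerate_alg B -> nondegenerate_alg (tensor A B).
Proof.
move=> ndA ndB; split=> t t0.
  apply: rmult_mright_eq0 => // b; apply: rmult_mleft_eq0 => // a.
  by have := t0 (a \ox b); rewrite -[t ** _]/(rmult (mincl _) t) mincl_tens.
apply: lmult_mright_eq0 => // b; apply: lmult_mleft_eq0 => // a.
by have := t0 (a \ox b); rewrite -[_ ** t]/(lmult (mincl _) t) mincl_tensC.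
Qed.

Lemma lmult_inj (A : nuAlgType K) (m n : multiplier A) :
  nondegenerate_alg A -> lmult m =1 lmult n -> m = n.
Proof.
move=> [ndl _] mn; apply: multiplier_ext => // x.
apply/eqP; rewrite -subr_eq0; apply/eqP/ndl => y.
by rewrite linearBl /= -!multC mn subrr.
Qed.

Lemma rmult_inj (A : nuAlgType K) (m n : multiplier A) :
  nondegenerate_alg A -> rmult m =1 rmult n -> m = n.
Proof.
move=> [_ ndr] mn; apply: multiplier_ext => // x.
apply/eqP; rewrite -subr_eq0; apply/eqP/ndr => y.
by rewrite linearBr /= !multC mn subrr.
Qed.

End Nondegenerate.

Section LegMultiplication.
Variables (K : fieldType) (A B : nuAlgType K).

Definition rmul1 (a : A) : tensor A B -> tensor A B := rmult (mtens (mincl a) 1).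
Definition rmul2 (b : B) : tensor A B -> tensor A B := rmult (mtens 1 (mincl b)).
Definition lmul1 (a : A) : tensor A B -> tensor A B := lmult (mtens (mincl a) 1).

HB.instance Definition _ (a : A) := GRing.isLinear.Build K
  (tensor A B) (tensor A B) *:%R (rmul1 a) (rmult_linear (mtens (mincl a) 1)).
HB.instance Definition _ (b : B) := GRing.isLinear.Build K
  (tensor A B) (tensor A B) *:%R (rmul2 b) (rmult_linear (mtens 1 (mincl b))).
HB.instance Definition _ (a : A) := GRing.isLinear.Build K
  (tensor A B) (tensor A B) *:%R (lmul1 a) (lmult_linear (mtens (mincl a) 1)).

Lemma rmul1E c a b : rmul1 c (a \ox b) = (a ** c) \ox b.
Proof. exact: tmapE. Qed.

Lemma rmul2E c a b : rmul2 c (a \ox b) = a \ox (b ** c).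
Proof. exact: tmapE. Qed.

Lemma lmul1E c a b : lmul1 c (a \ox b) = (c ** a) \ox b.
Proof. exact: tmapE. Qed.

End LegMultiplication.

Arguments rmul1 {K A B} a x : simpl never.
Arguments rmul2 {K A B} b x : simpl never.
Arguments lmul1 {K A B} a x : simpl never.

Section Legs.
Variable K : fieldType.

Section Swap23.
Variables U V W : lmodType K.

Definition tswap23 (x : tensor (tensor U V) W) : tensor (tensor U W) V :=
  tunassoc (tmap idfun (@tswap K V W) (tassoc x)).

Lemma tswap23_linear : linear tswap23.
Proof. by move=> c x y; rewrite /tswap23 !linearP. Qed.

HB.instance Definition _ := GRing.isLinear.Build K
  (tensor (tensor U V) W) (tensor (tensor U W) V) *:%R tswap23 tswap23_linear.

Lemma tswap23E u v w : tswap23 ((u \ox v) \ox w) = (u \ox w) \ox v.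
Proof. by rewrite /tswap23 tassocE tmapE /= tswapE tunassocE. Qed.

End Swap23.

Lemma tswap23K (U V W : lmodType K) : cancel (@tswap23 U V W) (@tswap23 U W V).
Proof.
apply: (@tensor_extl _ _ _ _ _ (@tswap23 U W V \o @tswap23 U V W) idfun) => u v w /=.
by rewrite !tswap23E.
Qed.

Section LegMaps.
Variables (A : lmodType K) (F : {linear tensor A A -> tensor A A}).

Definition leg12 (x : tensor (tensor A A) A) : tensor (tensor A A) A :=
  tmap F idfun x.

Lemma leg12_linear : linear leg12.
Proof. exact: tmap_linear. Qed.

HB.instance Definition _ := GRing.isLinear.Build K
  (tensor (tensor A A) A) (tensor (tensor A A) A) *:%R leg12 leg12_linear.

Lemma leg12E t c : leg12 (t \ox c) = F t \ox c.
Proof. exact: tmapE. Qed.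

Definition leg13 (x : tensor (tensor A A) A) : tensor (tensor A A) A :=
  tswap23 (leg12 (tswap23 x)).

Lemma leg13_linear : linear leg13.
Proof. by move=> c x y; rewrite /leg13 !linearP. Qed.

HB.instance Definition _ := GRing.isLinear.Build K
  (tensor (tensor A A) A) (tensor (tensor A A) A) *:%R leg13 leg13_linear.

Lemma leg13E a b c : leg13 ((a \ox b) \ox c) = tswap23 (F (a \ox c) \ox b).
Proof. by rewrite /leg13 tswap23E leg12E. Qed.

End LegMaps.

Lemma leg12K (A : lmodType K) (F G : {linear tensor A A -> tensor A A}) :
  cancel F G -> cancel (leg12 F) (leg12 G).
Proof.
move=> FK; apply: (@tensor_ext _ _ _ _ (leg12 G \o leg12 F) idfun) => t c /=.
by rewrite !leg12E FK.
Qed.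

Lemma leg13K (A : lmodType K) (F G : {linear tensor A A -> tensor A A}) :
  cancel F G -> cancel (leg13 F) (leg13 G).
Proof. by move=> FK x; rewrite /leg13 tswap23K (leg12K FK) tswap23K. Qed.

Lemma leg13_swap (A : lmodType K) (F : {linear tensor A A -> tensor A A}) x :
  leg13 F (tswap23 x) = tswap23 (leg12 F x).
Proof. by rewrite /leg13 tswap23K. Qed.

Lemma leg12_swap (A : lmodType K) (F : {linear tensor A A -> tensor A A}) x :
  leg12 F (tswap23 x) = tswap23 (leg13 F x).
Proof. by rewrite /leg13 tswap23K. Qed.

Variable A : nuAlgType K.

Definition mulm : tensor A A -> A := tlift (@numul_bilinear K A).

HB.instance Definition _ := GRing.isLinear.Build K (tensor A A) A *:%R mulm
  (tlift_linear (@numul_bilinear K A)).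

Lemma mulmE a b : mulm (a \ox b) = a ** b.
Proof. exact: tlift_tens. Qed.

Definition lslice (f : {scalar A}) (x : tensor A A) : A := slice f (tswap x).

Lemma lslice_linear f : linear (lslice f).
Proof. by move=> c x y; rewrite /lslice !linearP. Qed.

HB.instance Definition _ (f : {scalar A}) :=
  GRing.isLinear.Build K (tensor A A) A *:%R (lslice f) (lslice_linear f).

Lemma lsliceE f a b : lslice f (a \ox b) = f a *: b.
Proof. by rewrite /lslice tswapE sliceE. Qed.

End Legs.

(* [D a] is left multiplication by [Delta a]; [F] sends [a \ox b] to
   [Delta(a)(1 \ox b)] and [G] sends [a \ox c] to the flip of
   [Delta(a)(c \ox 1)]; [gp_FG] is left coassociativity. *)
Record galois_pair (K : fieldType) (A : nuAlgType K)
    (D : A -> {linear tensor A A -> tensor A A})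
    (F F' G G' : {linear tensor A A -> tensor A A}) : Prop := GaloisPair {
  gp_FK : cancel F F';
  gp_F'K : cancel F' F;
  gp_GK : cancel G G';
  gp_G'K : cancel G' G;
  gp_DF : forall a p q,
    D a (p \ox q) = rmul1 p (F (a \ox q));
  gp_DG : forall a p q,
    tswap (D a (p \ox q)) = rmul1 q (G (a \ox p));
  gp_FD : forall a a' b, D a (F (a' \ox b)) = F ((a ** a') \ox b);
  gp_GD : forall a a' b,
    D a (tswap (G (a' \ox b))) = tswap (G ((a ** a') \ox b));
  gp_Fr : forall b x,
    F (rmul2 b x) = rmul2 b (F x);
  gp_Gr : forall b x,
    G (rmul2 b x) = rmul2 b (G x);
  gp_FG : forall x, leg12 F (leg13 G x) = leg13 G (leg12 F x)
}.

Section GaloisPair.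
Variables (K : fieldType) (A : nuAlgType K).
Local Notation AA := (tensor A A).

Definition conj_swap (f : {linear AA -> AA}) (x : AA) : AA := tswap (f (tswap x)).

Lemma conj_swap_linear f : linear (conj_swap f).
Proof. by move=> c x y; rewrite /conj_swap !linearP. Qed.

HB.instance Definition _ (f : {linear AA -> AA}) :=
  GRing.isLinear.Build K AA AA *:%R (conj_swap f) (conj_swap_linear f).

Definition is_antipode (F' G : {linear AA -> AA}) (eps : {scalar A})
    (S : {linear A -> A}) : Prop :=
  [/\ forall a b, lslice eps (F' (a \ox b)) = S a ** b,
      forall a b, S (a ** b) = S b ** S a &
      forall c d, lslice eps (F' (tswap (G (d \ox c)))) = eps d *: S c].

Variables (D : A -> {linear AA -> AA}) (F F' G G' : {linear AA -> AA}).
Hypothesis gpP : galois_pair D F F' G G'.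

Lemma galois_pair_swap :
  galois_pair (fun a => conj_swap (D a)) G G' F F'.
Proof.
case: gpP => FK F'K GK G'K DF DG FD GD Fr Gr FG; split=> //.
- by move=> a p q; rewrite /= /conj_swap tswapE DG.
- by move=> a p q; rewrite /= /conj_swap tswapE tswapK DF.
- by move=> a a' b; rewrite /= /conj_swap GD tswapK.
- by move=> a a' b; rewrite /= /conj_swap tswapK FD.
move=> x; rewrite -[x]tswap23K; move: (tswap23 x) => y.
by rewrite leg13_swap !leg12_swap leg13_swap FG.
Qed.

Lemma leg12F'_leg13G x : leg12 F' (leg13 G x) = leg13 G (leg12 F' x).
Proof.
have FF' := leg12K (gp_F'K gpP); have F'F := leg12K (gp_FK gpP).
by rewrite -[in LHS](FF' x) -(gp_FG gpP) F'F.
Qed.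

Lemma leg12F_leg13G' x : leg12 F (leg13 G' x) = leg13 G' (leg12 F x).
Proof.
have GG' := leg13K (gp_G'K gpP); have G'G := leg13K (gp_GK gpP).
by rewrite -[in RHS](GG' x) (gp_FG gpP) G'G.
Qed.

Lemma mulm_leg13 x c :
  tmap (@mulm K A) idfun (leg13 G (x \ox c)) = tswap (rmul1 c (F x)).
Proof.
elim/tensor_ind: x => [|e p q x IH]; first by rewrite linear0l !linear0.
rewrite linearPl !linearP /= IH; congr (_ *: _ + _).
rewrite leg13E -(gp_DF gpP) (gp_DG gpP).
elim/tensor_ind: (G _) => [|e' u v y IHy]; first by rewrite linear0l !linear0.
rewrite linearPl !linearP /= IHy; congr (_ *: _ + _).
by rewrite tswap23E !tmapE /= mulmE rmul1E.
Qed.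

Lemma mulm_leg12 w b :
  tmap (@mulm K A) idfun (leg12 F' (tswap23 (w \ox b))) = b \ox mulm (G' w).
Proof.
rewrite -[w](gp_G'K gpP) (gp_GK gpP).
elim/tensor_ind: (G' w) => [|e a c y IHy]; first by rewrite !(linear0l, linear0, linear0r).
rewrite !(linearPl, linearPr, linearP) /= IHy; congr (_ *: _ + _).
rewrite -leg13E leg12F'_leg13G leg12E mulm_leg13 (gp_F'K gpP).
by rewrite rmul1E tswapE mulmE.
Qed.

Lemma counit_exists : exists f : {scalar A},
  (forall x, mulm (F' x) = lslice f x) /\ (forall x, mulm (G' x) = lslice f x).
Proof.
have [[z z0]|A0] := pselect (exists z : A, z != 0); last first.
  have all0 (a : A) : a = 0 by apply/eqP; apply: contra_notT A0 => ?; exists a.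
  have /scalar_fun[f _] : scalar (fun _ : A => 0 : K).
    by move=> c u v /=; rewrite mulr0 addr0.
  by exists f; split=> x; rewrite [LHS]all0 [RHS]all0.
have [h hz] := scalar_neq0 z0.
have /scalar_fun[f fE] : scalar (fun y => h (mulm (G' (y \ox z)))).
  by move=> c u v /=; rewrite linearPl !linearP.
exists f.
have key y t b : mulm (F' (y \ox b)) \ox t = b \ox mulm (G' (y \ox t)).
  by rewrite -mulm_leg12 tswap23E leg12E tmapE.
have F'E y b : mulm (F' (y \ox b)) = f y *: b.
  by have /(congr1 (slice h)) := key y z b; rewrite !sliceE hz scale1r fE.
split; [apply: (@tensor_ext _ _ _ _ (@mulm K A \o F') (lslice _))|
        apply: (@tensor_ext _ _ _ _ (@mulm K A \o G') (lslice _))] => y b /=.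
  by rewrite lsliceE F'E.
rewrite lsliceE.
have := key y b z; rewrite F'E => /(congr1 (lslice h)).
by rewrite !lsliceE linearZ /= hz mulr1 scale1r => <-.
Qed.

Variable eps : {scalar A}.
Hypothesis F'_counit : forall x, mulm (F' x) = lslice eps x.

Lemma lslice_F x : lslice eps (F x) = mulm x.
Proof. by rewrite -F'_counit (gp_FK gpP). Qed.

Lemma D_F p x : D p (F x) = F (lmul1 p x).
Proof.
apply: (@tensor_ext _ _ _ _ (D p \o F) (F \o lmul1 p)) => a b /=.
by rewrite (gp_FD gpP) lmul1E.
Qed.

Lemma lslice_D p x : lslice eps (D p x) = p ** lslice eps x.
Proof.
rewrite -[x](gp_F'K gpP) D_F !lslice_F.
elim/tensor_ind: (F' x) => [|e a b y IHy]; first by rewrite !(linear0, numul0r).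
by rewrite !linearP /= IHy lmul1E !mulmE numulA.
Qed.

Lemma lslice_rmul1 c x : lslice eps (rmul1 c x) = eps c *: lslice eps x.
Proof.
rewrite -[x](gp_F'K gpP).
elim/tensor_ind: (F' x) => [|e a b y IHy]; first by rewrite !linear0.
rewrite !linearP /= IHy; congr (_ *: _ + _).
by rewrite -(gp_DF gpP) lslice_D lsliceE linearZr_LR lslice_F mulmE.
Qed.

Lemma lslice_lmul1 c x : lslice eps (lmul1 c x) = eps c *: lslice eps x.
Proof.
elim/tensor_ind: x => [|e a b y IHy]; first by rewrite !linear0.
rewrite !linearP /= IHy; congr (_ *: _ + _).
rewrite lmul1E -rmul1E lslice_rmul1 !lsliceE !scalerA.
by rewrite mulrC.
Qed.

Lemma lslice_rmul2 c x : lslice eps (rmul2 c x) = lslice eps x ** c.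
Proof.
elim/tensor_ind: x => [|e a b y IHy]; first by rewrite !linear0 numul0l.
by rewrite !linearP /= IHy numulDZl rmul2E !lsliceE linearZl_LR.
Qed.

(* [sigma (a \ox b)] will be [S a ** b]. *)
Local Notation sigma x := (lslice eps (F' x)).

Lemma sigma_D p x : sigma (D p x) = eps p *: sigma x.
Proof.
by rewrite -[in LHS](gp_F'K gpP x) D_F (gp_FK gpP) lslice_lmul1.
Qed.

Lemma sigma_rmul2 b x : sigma (rmul2 b x) = sigma x ** b.
Proof.
by rewrite -[in LHS](gp_F'K gpP x) -(gp_Fr gpP) (gp_FK gpP) lslice_rmul2.
Qed.

Lemma sigma_rmul1 c x : sigma (rmul1 c x) = sigma (c \ox sigma x).
Proof.
rewrite -[x](gp_F'K gpP) (gp_FK gpP).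
elim/tensor_ind: (F' x) => [|e p q y IHy]; first by rewrite !(linear0, linear0r).
rewrite !(linearPr, linearP) /= IHy; congr (_ *: _ + _).
by rewrite -(gp_DF gpP) sigma_D lsliceE linearZr_LR !linearZ.
Qed.

(* In Sweedler notation, [S(d_(1) c) d_(2) = eps(d) S(c)]. *)
Lemma sigma_swap_G c d q :
  sigma (tswap (G (d \ox c))) ** q = eps d *: sigma (c \ox q).
Proof.
rewrite -sigma_rmul2 -sigma_D -[D _ _]tswapK (gp_DG gpP).
by rewrite tswap_rmult.
Qed.

Hypothesis ndA : nondegenerate_alg A.

Lemma antipode_exists : exists S, is_antipode F' G eps S.
Proof.
have [[d d1]|e0] := pselect (exists d, eps d = 1); last first.
  have eps0 a : eps a = 0.
    apply/eqP; apply: contra_notT e0 => ea.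
    by exists ((eps a)^-1 *: a); rewrite linearZ /= mulVf.
  have all0 (a : A) : a = 0.
    apply: ndA.1 => b; rewrite -mulmE -lslice_F.
    elim/tensor_ind: (F _) => [|c u v y IHy]; first by rewrite linear0.
    by rewrite linearP /= IHy lsliceE eps0 scale0r scaler0 addr0.
  by exists idfun; split=> *; rewrite [LHS]all0 [RHS]all0.
pose S c := sigma (tswap (G (d \ox c))).
have SL : linear S by move=> c u v; rewrite /S linearPr !linearP.
exists (HB.pack_for {linear A -> A} S (GRing.isLinear.Build K A A *:%R S SL)) => /=.
have SE a b : sigma (a \ox b) = S a ** b by rewrite sigma_swap_G d1 scale1r.
have inj (u v : A) : (forall q, u ** q = v ** q) -> u = v.
  move=> uv; apply/eqP; rewrite -subr_eq0; apply/eqP/ndA.1 => q.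
  by rewrite linearBl /= uv subrr.
split=> // [a b|c d'].
  by apply: inj => q; rewrite -numulA -!SE -sigma_rmul1 rmul1E.
by apply: inj => q; rewrite sigma_swap_G SE linearZl_LR.
Qed.

End GaloisPair.

Section Antipode.
Variables (K : fieldType) (A : nuAlgType K).
Local Notation AA := (tensor A A).
Hypothesis ndA : nondegenerate_alg A.

Variables (D : A -> {linear AA -> AA}) (F F' G G' : {linear AA -> AA}).
Hypothesis gpP : galois_pair D F F' G G'.
Variable eps : {scalar A}.
Hypothesis F'_counit : forall x, mulm (F' x) = lslice eps x.
Variables S S' : {linear A -> A}.
Hypothesis SP : is_antipode F' G eps S.
Hypothesis S'P : is_antipode G' F eps S'.

Lemma antipode'_swap x :
  lslice eps (G' (tswap x)) = S' (lslice eps (F' x)).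
Proof.
rewrite -[x](gp_F'K gpP) (gp_FK gpP).
elim/tensor_ind: (F' x) => [|e p q y IHy]; first by rewrite !linear0.
rewrite !linearP /= IHy; congr (_ *: _ + _).
by have [_ _ ->] := S'P; rewrite lsliceE linearZ.
Qed.

Lemma lslice_leg12_F w b :
  tmap (lslice eps) idfun (leg12 F (tswap23 (w \ox b))) = rmul1 b w.
Proof.
elim/tensor_ind: w => [|e p q w IHw]; first by rewrite linear0l !linear0.
rewrite linearPl !linearP /= IHw; congr (_ *: _ + _).
by rewrite tswap23E leg12E tmapE /= (lslice_F gpP F'_counit) mulmE rmul1E.
Qed.

Lemma antipode'_regular z : (forall b, S' b ** z = 0) -> z = 0.
Proof.
move=> S'z; have leg13_0 x : tmap (lslice eps) idfun (leg13 G' (x \ox z)) = 0.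
  elim/tensor_ind: x => [|e p q x IHx]; first by rewrite linear0l !linear0.
  rewrite linearPl !linearP /= IHx addr0 leg13E.
  have -> w : tmap (lslice eps) idfun (tswap23 (w \ox q)) = q \ox lslice eps w.
    elim/tensor_ind: w => [|e' u v w IHw].
      by rewrite linear0l !linear0 linear0r.
    rewrite linearPl !linearP /= linearPr IHw; congr (_ *: _ + _).
    by rewrite tswap23E tmapE /= !lsliceE linearZl_LR linearZr_LR.
  by have [-> _ _] := S'P; rewrite S'z linear0r scaler0.
have G'z : G' (z \ox z) = 0.
  apply: (@rmult_mleft_eq0 _ A A) => // b.
  rewrite -[LHS]/(rmul1 b _) -lslice_leg12_F -leg13E.
  by rewrite (leg12F_leg13G' gpP) leg12E leg13_0.
apply/eqP; apply: contraT => z0.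
have := tens_neq0 z0 z0.
by rewrite -[_ \ox _](gp_G'K gpP) G'z linear0 eqxx.
Qed.

Lemma antipodeK : cancel S S'.
Proof.
move=> a; apply/esym/eqP; rewrite -subr_eq0; apply/eqP/antipode'_regular => b.
have := antipode'_swap (a \ox b); rewrite tswapE.
have [-> S'M _] := S'P; have [-> _ _] := SP; rewrite S'M => e.
by rewrite linearBr /= e subrr.
Qed.

(* In Sweedler notation: [S c ** a_(1) \ox a_(2)] is the image under
   [S \ox iota] of [S^-1 (a_(1)) ** c \ox a_(2)], the inverse of [T4] at
   [c \ox a]. *)
Lemma lmul1_antipode c a x z :
  lmul1 (S c) (D a (x \ox z)) = tmap S idfun (tswap (G' (a \ox c))) ** (x \ox z).
Proof.
pose Q : {linear tensor AA A -> AA} :=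
  tmap (@mulm K A \o tmap S idfun \o @tswap K A A) idfun \o @tswap23 K A A A.
have QE y d : Q (y \ox d) = lmul1 (S d) y.
  rewrite /Q /=; elim/tensor_ind: y => [|e p q y IHy].
    by rewrite linear0l !linear0.
  rewrite linearPl !linearP /= IHy; congr (_ *: _ + _).
  by rewrite tswap23E tmapE /= tswapE tmapE mulmE lmul1E.
have Q_leg13 y d : Q (leg13 G (y \ox d)) = S d \ox lslice eps y.
  rewrite /Q /=; elim/tensor_ind: y => [|e p q y IHy].
    by rewrite linear0l !linear0 linear0r.
  rewrite linearPl !linearP /= linearPr IHy; congr (_ *: _ + _).
  rewrite leg13E tswap23K tmapE /= lsliceE linearZr_LR -linearZl_LR /=.
  have [SE _ <-] := SP; congr (_ \ox _).
  elim/tensor_ind: (tswap _) => [|e' u v w IHw]; first by rewrite !linear0.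
  by rewrite !linearP /= IHw tmapE mulmE SE.
clearbody Q.
have key w : rmul1 x (Q (leg12 F (tswap23 (w \ox z)))) =
    tmap S idfun (tswap (G' w)) ** (x \ox z).
  rewrite -[w](gp_G'K gpP) (gp_GK gpP).
  elim/tensor_ind: (G' w) => [|e h d y IHy].
    by rewrite linear0 !linear0l !linear0 numul0l.
  rewrite linearP linearPl !linearP /= numulDZl IHy; congr (_ *: _ + _).
  rewrite -leg13E (gp_FG gpP) leg12E Q_leg13 (lslice_F gpP F'_counit) mulmE.
  by rewrite tswapE tmapE rmul1E tens_mulE.
rewrite -key tswap23E leg12E QE (gp_DF gpP).
elim/tensor_ind: (F _) => [|e p q y IHy]; first by rewrite !linear0.
by rewrite !linearP /= IHy !(rmul1E, lmul1E) numulA.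
Qed.

End Antipode.

Lemma tswapM (K : fieldType) (A B : nuAlgType K) (x y : tensor A B) :
  tswap (x ** y) = tswap x ** tswap y.
Proof.
elim/tensor_ind: x => [|e a b x IHx].
  by rewrite numul0l linear0 numul0l.
rewrite numulDZl !tswap_linear numulDZl IHx; congr (_ *: _ + _) => {IHx x}.
elim/tensor_ind: y => [|e' c d y IHy].
  by rewrite numul0r !linear0.
rewrite numulDZr !tswap_linear numulDZr IHy; congr (_ *: _ + _).
by rewrite tens_mulE !tswapE tens_mulE.
Qed.

Lemma massocM (K : fieldType) (A B C : nuAlgType K)
    (m n : multiplier (tensor A (tensor B C))) :
  massoc (m * n) = massoc m * massoc n.
Proof. by apply: multiplier_ext => x /=; rewrite tunassocK. Qed.

Lemma lmul1_bijection (K : fieldType) (A : nuAlgType K)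
    (D : A -> {linear tensor A A -> tensor A A})
    (F F' G G' : {linear tensor A A -> tensor A A}) :
  nondegenerate_alg A -> galois_pair D F F' G G' ->
  exists2 t : {linear tensor A A -> tensor A A}, bijective t &
    forall c a x z, lmul1 c (D a (x \ox z)) = t (c \ox a) ** (x \ox z).
Proof.
move=> ndA gpP; have gpP' := galois_pair_swap gpP.
have [eps [F'_counit G'_counit]] := counit_exists gpP.
have [S SP] := antipode_exists gpP F'_counit ndA.
have [S' S'P] := antipode_exists gpP' G'_counit ndA.
have SK := antipodeK ndA gpP F'_counit SP S'P.
have S'K := antipodeK ndA gpP' G'_counit S'P SP.
pose t (H : {linear tensor A A -> tensor A A}) : {linear tensor A A -> tensor A A} :=
  tmap S idfun \o conj_swap H \o tmap S' idfun.
have tmapK (f g : {linear A -> A}) :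
    cancel f g -> cancel (tmap f (@idfun A)) (tmap g (@idfun A)).
  move=> fK; apply: (@tensor_ext _ _ _ _ (tmap g idfun \o tmap f idfun) idfun).
  by move=> u v /=; rewrite !tmapE /= fK.
have tK (H H' : {linear tensor A A -> tensor A A}) : cancel H H' -> cancel (t H) (t H').
  by move=> HK x; rewrite /t /= (tmapK _ _ SK) /conj_swap tswapK HK tswapK (tmapK _ _ S'K).
exists (t G'); first by exists (t G); apply: tK; [exact: gp_G'K gpP | exact: gp_GK gpP].
move=> c a x z; rewrite /t /= tmapE /conj_swap tswapE.
by rewrite -(lmul1_antipode gpP F'_counit SP) S'K.
Qed.

Section LeftMultiplierHopf.
Variables (K : fieldType) (A : nuAlgType K).
Local Notation AA := (tensor A A).
Local Notation AAA := (tensor (tensor A A) A).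
Hypothesis ndA : nondegenerate_alg A.
Variable Delta : {linear A -> multiplier AA}.
Hypothesis Delta_mul : {morph Delta : a b / a ** b >-> a * b}.

Let ndAA : nondegenerate_alg AA := tensor_nondegenerate ndA ndA.
Let ndAAA : nondegenerate_alg AAA := tensor_nondegenerate ndAA ndA.
Let inclI : injective (@mincl K AA) := mincl_inj ndAA.

Lemma bijective_on_tensor_linear (T : {linear AA -> multiplier AA}) :
  bijective_on_tensor T -> exists F F' : {linear AA -> AA},
    [/\ forall x, T x = mincl (F x), cancel F F' & cancel F' F].
Proof.
case=> t Tt [t' tK t'K].
have tL : linear t by move=> c x y; apply: inclI; rewrite -Tt !linearP /= !Tt.
have t'L : linear t' by move=> c x y; rewrite -[RHS]tK tL !t'K.
exists (HB.pack_for {linear AA -> AA} t (GRing.isLinear.Build K AA AA *:%R t tL)).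
by exists (HB.pack_for {linear AA -> AA} t' (GRing.isLinear.Build K AA AA *:%R t' t'L)).
Qed.

Lemma mleftM (b c : A) : mleft (b ** c) = mleft b * mleft c.
Proof. by rewrite /mleft -mtensM mulr1 minclM. Qed.

Lemma mrightM (b c : A) : mright (b ** c) = mright b * mright c.
Proof. by rewrite /mright -mtensM mulr1 minclM. Qed.

Section Pair.
Variables F F' T T' : {linear AA -> AA}.
Hypothesis FE : forall x, T1 Delta x = mincl (F x).
Hypothesis FK : cancel F F'.
Hypothesis F'K : cancel F' F.
Hypothesis TE : forall x, T4 Delta x = mincl (T x).
Hypothesis TK : cancel T T'.
Hypothesis T'K : cancel T' T.
Hypothesis coassoc : left_coassociative Delta.

Lemma F_tens a b : mincl (F (a \ox b)) = Delta a * mright b.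
Proof. by rewrite -FE T1E. Qed.

Lemma T_tens c a : mincl (T (c \ox a)) = Delta a * mleft c.
Proof. by rewrite -TE T4E. Qed.

Lemma Delta_iota_mleft x c :
  exists2 z, Delta_iota Delta x * mtens (mleft c) 1 = mincl z &
    tswap23 (tmap (@tswap K A A) idfun z) = leg13 (conj_swap T) (x \ox c).
Proof.
elim/tensor_ind: x => [|e p q x [z xz zE]].
  by exists 0; rewrite ?linear0l !linear0 ?mul0r.
exists (e *: (T (c \ox p) \ox q) + z).
  rewrite !linearP mulrDl -mult_scaleAl xz /= Delta_iotaE -mtensM mulr1.
  by rewrite -T_tens mtens_mincl.
rewrite linearPl !linearP /= zE; congr (_ *: _ + _).
by rewrite tmapE leg13E /= /conj_swap tswapE.
Qed.

Lemma iota_Delta_mright y b :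
  exists2 z, massoc (iota_Delta Delta y) * mtens (mtens 1 1) (mincl b) = mincl z &
    tswap23 (tmap (@tswap K A A) idfun z) = leg12 F (tswap23 (tswap y \ox b)).
Proof.
have mright_massoc : mtens (mtens 1 1) (mincl b) = massoc (mtens (1 : multiplier A) (mright b)).
  by rewrite massoc_mtens.
have massoc_mincl (x : tensor A AA) : massoc (mincl x) = mincl (tunassoc x).
  by apply: multiplier_ext => t /=; rewrite tunassocM [tunassoc (tassoc t)]tassocK.
rewrite mright_massoc -massocM.
have [z zE zs] : exists2 z, iota_Delta Delta y * mtens 1 (mright b) = mincl z &
    tswap23 (tmap (@tswap K A A) idfun (tunassoc z)) = leg12 F (tswap23 (tswap y \ox b)).
  elim/tensor_ind: y => [|e p q y [z yz zE]].
    by exists 0; rewrite !linear0 ?linear0l ?mul0r // !linear0.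
  exists (e *: (p \ox F (q \ox b)) + z).
    rewrite !linearP mulrDl -mult_scaleAl yz /= iota_DeltaE -mtensM mulr1.
    by rewrite -F_tens mtens_mincl.
  rewrite !linearP /= linearPl !linearP /= zE tswapE tswap23E leg12E.
  congr (_ *: _ + _).
  elim/tensor_ind: (F _) => [|e' u v w IHw].
    by rewrite linear0r linear0l !linear0.
  rewrite linearPr linearPl !linearP /= IHw; congr (_ *: _ + _).
  by rewrite tunassocE tmapE /= tswapE tswap23E.
by exists (tunassoc z); rewrite ?zE ?massoc_mincl.
Qed.

Lemma leg_commute x :
  leg12 F (leg13 (conj_swap T) x) = leg13 (conj_swap T) (leg12 F x).
Proof.
apply: (@tensor_extl _ _ _ _ _ (leg12 F \o leg13 (conj_swap T))
  (leg13 (conj_swap T) \o leg12 F)) => a b c /=.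
rewrite leg12E leg13E /= /conj_swap tswapE.
have [z1 e1 <-] := Delta_iota_mleft (F (a \ox b)) c.
have [z2 e2 <-] := iota_Delta_mright (T (c \ox a)) b.
congr (tswap23 (tmap _ _ _)); apply: (mincl_inj ndAAA).
by rewrite -e1 -e2; apply/esym/coassoc; rewrite ?F_tens ?T_tens.
Qed.

Definition lmult_Delta (a : A) : {linear AA -> AA} := lmult (Delta a).

Lemma left_multiplier_galois_pair :
  galois_pair lmult_Delta F F' (conj_swap T) (conj_swap T').
Proof.
split=> //.
- by move=> x; rewrite /= /conj_swap tswapK TK tswapK.
- by move=> x; rewrite /= /conj_swap tswapK T'K tswapK.
- move=> a p q; apply: inclI; rewrite /lmult_Delta /= -mincl_ideall mincl_tens mulrA.
  by rewrite -[Delta a * _]F_tens mincl_idealr.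
- move=> a p q; rewrite /= /conj_swap tswapE /rmul1 -tswap_rmult; congr tswap.
  apply: inclI; rewrite /lmult_Delta /= -mincl_ideall mincl_tensC mulrA.
  by rewrite -[Delta a * _]T_tens mincl_idealr.
- move=> a a' b; apply: inclI.
  by rewrite -mincl_ideall !F_tens Delta_mul mulrA.
- move=> a a' b; apply: inclI.
  rewrite /= /conj_swap !tswapK !tswapE -mincl_ideall !T_tens Delta_mul.
  by rewrite mulrA.
- move=> b; apply: (@tensor_ext _ _ _ _ (F \o rmul2 b) (rmul2 b \o F)) => a c /=.
  apply: inclI; rewrite rmul2E F_tens -mincl_idealr F_tens -mulrA.
  by rewrite -mrightM.
- move=> b; apply: (@tensor_ext _ _ _ _ (conj_swap T \o rmul2 b)
    (rmul2 b \o conj_swap T)) => a c /=.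
  rewrite /= /conj_swap rmul2E !tswapE /rmul2 -tswap_rmult; congr tswap.
  apply: inclI; rewrite T_tens -mincl_idealr T_tens -mulrA.
  by rewrite -mleftM.
- exact: leg_commute.
Qed.

End Pair.

Lemma iota_Delta_lmul1 c x :
  iota_Delta Delta (lmul1 c x) = mtens (mincl c) 1 * iota_Delta Delta x.
Proof.
elim/tensor_ind: x => [|e p q x IHx]; first by rewrite !linear0 mulr0.
rewrite !linearP /= IHx mulrDr -mult_scaleAr lmul1E !iota_DeltaE.
by rewrite -mtensM -minclM mul1r.
Qed.

Lemma iota_Delta_rmul1 c x :
  iota_Delta Delta (rmul1 c x) = iota_Delta Delta x * mtens (mincl c) 1.
Proof.
elim/tensor_ind: x => [|e p q x IHx]; first by rewrite !linear0 mul0r.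
rewrite !linearP /= IHx mulrDl -mult_scaleAl rmul1E !iota_DeltaE.
by rewrite -mtensM -minclM mulr1.
Qed.

Lemma mtens_mleft c :
  mtens (mleft c) 1 = massoc (mtens (mincl c) 1) :> multiplier AAA.
Proof. by rewrite -(@mtens1 K A A) massoc_mtens. Qed.

Lemma mul_mleft_inj (M N : multiplier AAA) :
  (forall z, M * mtens (mleft z) 1 = N * mtens (mleft z) 1) -> M = N.
Proof.
move=> MN; apply: rmult_inj => // w.
apply/eqP; rewrite -subr_eq0; apply/eqP.
apply: (@rmult_mleft_eq0 _ AA A) => // t.
have MNt : M * mtens (mincl t) 1 = N * mtens (mincl t) 1.
  elim/tensor_ind: t => [|e u v t IHt].
    have := (mtens_bilinear AA A).1 1 (-1) 0 0; rewrite scaler0 addr0 /= => e.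
    by move: e; rewrite linear0 scaleN1r addNr => ->; rewrite !mulr0.
  rewrite mincl_linear (mtens_bilinear _ _).1 !mulrDr -!mult_scaleAr IHt.
  rewrite mincl_tensC -[1]mulr1 mtensM !mulrA mulr1.
  by rewrite -/(mleft u) MN.
rewrite linearB; apply/eqP; rewrite subr_eq0; apply/eqP.
exact: (congr1 (fun m : multiplier AAA => rmult m w) MNt).
Qed.

(* Multiplication by [z \ox 1 \ox 1] on the right reduces coassociativity to its
   left version, because [c \ox 1] and [z \ox 1] act on [Delta(a)] from both
   sides. *)
Lemma left_coassociative_coassociative :
  regular_map (T4 Delta) -> left_coassociative Delta -> coassociative Delta.
Proof.
move=> T4_reg coassoc a b c x y ex ey; apply: mul_mleft_inj => z.
have [yz] := T4_reg (z \ox a); rewrite T4E => eyz.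
have yE : lmul1 c yz = rmul1 z y.
  by apply: inclI; rewrite -mincl_ideall -mincl_idealr -eyz -ey mulrA.
rewrite -mulrA (coassoc a b z x yz) // mulrA -/(mleft c) mtens_mleft.
rewrite -massocM -iota_Delta_lmul1 yE iota_Delta_rmul1 massocM -mtens_mleft.
by rewrite -!mulrA !mtens1 -!mtensM !mulr1 !mul1r.
Qed.

Lemma left_multiplier_hopf_regular :
  left_multiplier_hopf Delta -> regular_multiplier_hopf Delta.
Proof.
case=> -[T1_reg T4_reg] coassoc T1_bij T4_bij.
have [F [F' [FE FK F'K]]] := bijective_on_tensor_linear T1_bij.
have [T [T' [TE TK T'K]]] := bijective_on_tensor_linear T4_bij.
have gpP := left_multiplier_galois_pair FE FK F'K TE TK T'K coassoc.
have T2_bij : bijective_on_tensor (T2 Delta).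
  have [t t_bij tE] := lmul1_bijection ndA gpP.
  exists t => //; apply: (@tensor_ext _ _ _ _ (T2 Delta) (@mincl _ _ \o t)) => c a /=.
  rewrite T2E; apply: lmult_inj => // x.
  elim/tensor_ind: x => [|e x z u IHu]; first by rewrite !linear0.
  by rewrite !lmult_linear IHu -[lmult (mincl _) (x \ox z)]/(_ ** _) -tE.
have T3_bij : bijective_on_tensor (T3 Delta).
  have [t t_bij tE] := lmul1_bijection ndA (galois_pair_swap gpP).
  exists (conj_swap t).
    apply: (@tensor_ext _ _ _ _ (T3 Delta) (@mincl _ _ \o conj_swap t)) => a b /=.
    rewrite T3E; apply: lmult_inj => // x.
    elim/tensor_ind: x => [|e x z u IHu]; first by rewrite !linear0.
    rewrite !lmult_linear IHu; congr (_ *: _ + _).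
    rewrite -[RHS]/(_ ** _) /conj_swap -[x \ox z](tswapE z x) (tswapE a b) -tswapM -tE.
    by rewrite /lmul1 tswap_lmult [LHS]/= /conj_swap tswapK.
  case: t_bij => t' tK t'K.
  by exists (fun x => tswap (t' (tswap x))) => x; rewrite /conj_swap tswapK ?tK ?t'K tswapK.
have reg S : bijective_on_tensor S -> @regular_map K A S.
  by case=> t tE _ x; exists (t x).
have coassoc' := left_coassociative_coassociative T4_reg coassoc.
by split; split; auto.
Qed.

End LeftMultiplierHopf.

Theorem theorem4p8 (R : realType) (A : nuAlgType R[i])
    (A_nondegenerate : nondegenerate_alg A)
    (Delta : {linear A -> multiplier (tensor A A)})
    (Delta_mul : {morph Delta : a b / a ** b >-> a * b}) :
  left_multiplier_hopf Delta -> regular_multiplier_hopf Delta.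
Proof. exact: left_multiplier_hopf_regular. Qed.
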